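(* Let $r\ge1$ and $n\ge 1$, and let $\det:\mathrm{GL}_r\to\mathbb G_m$ be the determinant. Pullback along $\det$ induces a bijection \[ \det{}^*:\{\text{invariant algebraic } D\text{-modules of rank } n \text{ on } \mathbb G_m\}/\!\sim\;\longrightarrow\;\{\text{invariant algebraic } D\text{-modules of rank } n \text{ on } \mathrm{GL}_r\}/\!\sim, \] where $\sim$ denotes isomorphism of $D$-modules.
   Context: For a complex affine algebraic group $G$, an invariant algebraic $D$-module of rank $n$ on $G$ is a $\mathcal D_G$-module $M_\alpha$ where $\alpha$ is an $n\times n$ matrix of left-invariant Kähler $1$-forms on $G$ satisfying $d\alpha+\alpha\wedge\alpha=0$, and $M_\alpha$ is $\mathbb C[G]^{\oplus n}$ with vector fields acting on the standard basis by $v(e_1,\dots,e_n)=(e_1,\dots,e_n)\alpha(v)$, extended by the Leibniz rule; i.e. the flat connection $d+\alpha$ on the trivial rank-$n$ bundle. Pullback along the homomorphism $\det$ sends the connection $d+\alpha$ on $\mathbb G_m$ to $d+\det^*\alpha$ on $\mathrm{GL}_r$, which is again invariant and flat. *)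

(* Defs.v *)
From HB Require Import structures.
From mathcomp Require Import all_boot all_order all_algebra.
From mathcomp Require Import complex.
From mathcomp Require Import reals.
Set Implicit Arguments. Unset Strict Implicit. Unset Printing Implicit Defensive.
Import Order.TTheory GRing.Theory Num.Theory.
Local Open Scope ring_scope.

Section InvDmod.
Variable C : fieldType.

(** Complex points of GL_r (the group is an affine variety; since C will be
    infinite, regular functions are determined by their values on points). *)
Definition GLpt (r : nat) : Type := {A : 'M[C]_r | A \in unitmx}.

Inductive is_polyfun (r : nat) : ('M[C]_r -> C) -> Prop :=
| pf_const (c : C) : is_polyfun (fun _ => c)
| pf_coord (i j : 'I_r) : is_polyfun (fun A => A i j)
| pf_add f g : is_polyfun f -> is_polyfun g -> is_polyfun (fun A => f A + g A)
| pf_mul f g : is_polyfun f -> is_polyfun g -> is_polyfun (fun A => f A * g A).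

Definition regular (r : nat) (f : GLpt r -> C) : Prop :=
  exists (P : 'M[C]_r -> C) (k : nat),
    is_polyfun P /\ forall x : GLpt r, f x = P (val x) / \det (val x) ^+ k.

Definition regmx (r p q : nat) (F : GLpt r -> 'M[C]_(p, q)) : Prop :=
  forall i j, regular (fun x => F x i j).

Definition vfield (r : nat) := (GLpt r -> C) -> (GLpt r -> C).

Definition derivation (r : nat) (v : vfield r) : Prop :=
  [/\ forall f, regular f -> regular (v f),
      forall f g, regular f -> regular g ->
        v (fun x => f x + g x) = (fun x => v f x + v g x),
      forall (c : C) f, regular f -> v (fun x => c * f x) = (fun x => c * v f x)
    & forall f g, regular f -> regular g ->
        v (fun x => f x * g x) = (fun x => v f x * g x + f x * v g x)].

Definition vbracket (r : nat) (u v : vfield r) : vfield r :=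
  fun f x => u (v f) x - v (u f) x.

Definition Dmx (r p q : nat) (v : vfield r) (F : GLpt r -> 'M[C]_(p, q))
  : GLpt r -> 'M[C]_(p, q) :=
  fun x => \matrix_(i, j) v (fun y => F y i j) x.

(** The Maurer--Cartan form g^-1 dg paired with a vector field v: its
    entries span the left-invariant Kaehler 1-forms on GL_r. *)
Definition MaurerCartan (r : nat) (v : vfield r) : GLpt r -> 'M[C]_r :=
  fun x => invmx (val x) *m Dmx v (fun y => val y) x.

(** A matrix alpha of Kaehler 1-forms is encoded by its pairing with vector
    fields:  v |-> alpha(v), a matrix of functions. *)
Definition pairing (r n : nat) := vfield r -> GLpt r -> 'M[C]_n.

(** An n x n matrix of left-invariant 1-forms: entry (k,l) is
    sum_(i,j) a k l i j * (g^-1 dg)_(i,j). *)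
Definition invform (r n : nat) := 'I_n -> 'I_n -> 'M[C]_r.

Definition inv_pairing (r n : nat) (a : invform r n) : pairing r n :=
  fun v x => \matrix_(k, l) \sum_(i < r) \sum_(j < r)
                a k l i j * MaurerCartan v x i j.

(** flatness d alpha + alpha /\ alpha = 0, evaluated on pairs of vector
    fields (Cartan formula for d). *)
Definition flat (r n : nat) (al : pairing r n) : Prop :=
  forall u v, derivation u -> derivation v -> forall x : GLpt r,
    Dmx u (al v) x - Dmx v (al u) x - al (vbracket u v) x
    + al u x *m al v x - al v x *m al u x = 0.

(** Action of a vector field on a section f (column of coordinates with
    respect to the standard basis e) of the module M_alpha:
    v((e_1..e_n) f) = (e_1..e_n) (alpha(v) f + v(f)). *)
Definition dact (r n : nat) (al : pairing r n) (v : vfield r)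
  (f : GLpt r -> 'cV[C]_n) : GLpt r -> 'cV[C]_n :=
  fun x => Dmx v f x + al v x *m f x.

(** Morphisms of D_G-modules M_alpha -> M_beta: maps of sections which are
    C[G]-linear and commute with all vector fields (D_G is generated by
    C[G] and the vector fields). *)
Definition Dmod_hom (r n : nat) (al be : pairing r n)
  (phi : (GLpt r -> 'cV[C]_n) -> (GLpt r -> 'cV[C]_n)) : Prop :=
  [/\ forall f, regmx f -> regmx (phi f),
      forall f g, regmx f -> regmx g ->
        phi (fun x => f x + g x) = (fun x => phi f x + phi g x),
      forall c f, regular c -> regmx f ->
        phi (fun x => c x *: f x) = (fun x => c x *: phi f x)
    & forall v f, derivation v -> regmx f ->
        phi (dact al v f) = dact be v (phi f)].

Definition Dmod_iso (r n : nat) (al be : pairing r n) : Prop :=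
  exists phi psi, [/\ Dmod_hom al be phi, Dmod_hom be al psi,
     forall f, regmx f -> psi (phi f) = f
   & forall f, regmx f -> phi (psi f) = f].

(** G_m = GL_1.  Pullback of alpha = (a_kl t^-1 dt) along det : GL_r -> G_m:
    (det^* alpha)(v) = a_kl * det^-1 v(det). *)
Definition det_pullback (r n : nat) (a : invform 1 n) : pairing r n :=
  fun v x => \matrix_(k, l)
     (a k l ord0 ord0 * (v (fun y => \det (val y)) x / \det (val x))).

End InvDmod.

Arguments det_pullback {C} r {n} a.

(* Main.v *)
(** The form b is rho(g^-1 dg) for a linear map rho : gl_r -> gl_n, and flatness
    of b says that rho is a Lie algebra representation.  Its restriction to
    sl_r integrates: each rho(E_ij), i <> j, is nilpotent (it is an eigenvector
    of ad rho(E_ii - E_jj)), so t |-> exp(t rho(E_ij)) is polynomial, and over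
    the function field K of GL_r the group SL_r(K) is generated by
    transvections.  Integrating along s^-1 g, where g is the generic matrix and
    s = diag(1, .., 1, det g), gives G in GL_n(K) with
      dG = G rho(g^-1 dg) - dlog(det g) rho(E_rr) G,
    a rational isomorphism from M_b to det^* M_a with a = rho(E_rr) dt/t.  The
    ideal of common denominators of G (and of its inverse) is nonzero and
    stable under all derivations; since partial derivatives lower degrees it
    contains 1, so G is regular.  For injectivity, isomorphisms are pulled
    back along det and along the section t |-> diag(t, 1, .., 1). *)

Require Import Defs.
From HB Require Import structures.
From mathcomp Require Import all_boot all_order all_algebra.
From mathcomp Require Import complex reals.
From mathcomp Require Import boolp classical_sets functions.
From mathcomp Require Import perm generic_quotient fraction.
From mathcomp Require Import ring.
Set Implicit Arguments. Unset Strict Implicit. Unset Printing Implicit Defensive.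
Import Order.TTheory GRing.Theory Num.Theory.
Local Open Scope ring_scope.

(** What fails to integrate is the centre of gl_r: rho of a central element can have arbitrary
    eigenvalues, and its exponential is then not algebraic. Splitting gl_r into sl_r and scalars
    would moreover call for an r-th root of det g; the factor s comes from a section of det and
    avoids the root. Transvections are used over K and not matrix by matrix, because separate
    factorizations of the points of GL_r would not make G depend algebraically on g. The price is
    poles, since elimination divides by entries of the matrix; the differential equation of G
    removes them afterwards. A second obstacle is that vector fields are operators on all functions
    but are constrained only on regular ones. Regularity is therefore carried through every
    computation, and fields with prescribed values have to be constructed, which is done by
    differentiating along lines. *)

(** [H, N^k] = 2k N^k: if no power of N vanished, ad H would have infinitely
    many eigenvalues. *)
Lemma ad_eigen_nilpotent (C : numFieldType) (n : nat) (H N : 'M[C]_n) :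
  H *m N - N *m H = 2%:R *: N -> exists m, N ^+ m = 0.
Proof.
move=> HN; apply/not_existsP => Nn0.
have eig k : H *m N ^+ k - N ^+ k *m H = (2 * k)%:R *: N ^+ k.
  elim: k => [|k IH].
    by rewrite muln0 scale0r expr0 mulmx1 mul1mx subrr.
  rewrite exprS.
  have -> : (2 * k.+1)%:R = 2%:R + (2 * k)%:R :> C by rewrite -natrD mulnS.
  rewrite scalerDl -mulmxE [in RHS]scalemxAl -HN.
  rewrite [(2 * k)%:R *: _]scalemxAr -IH mulmxBl mulmxBr !mulmxA.
  by rewrite addrA subrK.
pose f : {linear 'M[C]_n -> 'M[C]_n} := mulmx H \- mulmxr H.
pose p := char_poly (lin_mx f).
(* [size p] is the degree plus one, so this list of distinct eigenvalues of ad H is one too long to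
   consist of roots of [p]. *)
pose s : seq C := [seq (2 * k)%:R | k <- iota 0 (size p)].
have ss : size s = size p by rewrite size_map size_iota.
have : (size s < size p)%N.
  apply: max_poly_roots.
  - by rewrite -size_poly_eq0 size_char_poly.
  - apply/allP => _ /mapP[k _ ->]; rewrite -eigenvalue_root_char.
    apply/eigenvalueP; exists (mxvec (N ^+ k)).
      by rewrite mul_vec_lin /= eig linearZ.
    by rewrite mxvec_eq0; apply/eqP/Nn0.
  - rewrite map_inj_uniq ?iota_uniq // => i j /eqP.
    by rewrite eqr_nat eqn_mul2l => /eqP.
by rewrite ss ltnn.
Qed.

(** * Leibniz rules for matrices over a ring with a derivation *)

Section MatrixDerivation.
Variables (B : comNzRingType) (D : B -> B).
Hypothesis DD : forall x y, D (x + y) = D x + D y.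
Hypothesis DM : forall x y, D (x * y) = D x * y + x * D y.

Lemma Leibniz0 : D 0 = 0.
Proof. by apply: (addrI (D 0)); rewrite -DD !addr0. Qed.

Lemma Leibniz1 : D 1 = 0.
Proof. by apply: (addrI (D 1)); rewrite addr0 -{3}(mulr1 1) DM mulr1 mul1r. Qed.

Lemma LeibnizN x : D (- x) = - D x.
Proof. by apply: (addrI (D x)); rewrite -DD !subrr Leibniz0. Qed.

Lemma Leibniz_sum (I : Type) (s : seq I) (P : pred I) (F : I -> B) :
  D (\sum_(i <- s | P i) F i) = \sum_(i <- s | P i) D (F i).
Proof. exact: (big_morph D DD Leibniz0). Qed.

Lemma LeibnizX x k : D (x ^+ k) = k%:R * x ^+ k.-1 * D x.
Proof.
elim: k => [|k IH]; first by rewrite expr0 Leibniz1 !mul0r.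
rewrite exprS DM IH /=; case: k IH => [|k] IH; first by rewrite !expr0; ring.
by rewrite /= -[k.+2]addn1 natrD exprS; ring.
Qed.

Lemma map_LeibnizM m n p (X : 'M[B]_(m, n)) (Y : 'M[B]_(n, p)) :
  map_mx D (X *m Y) = map_mx D X *m Y + X *m map_mx D Y.
Proof.
apply/matrixP => i j; rewrite !mxE Leibniz_sum -big_split /=.
by apply: eq_bigr => k _; rewrite DM !mxE.
Qed.

Lemma map_LeibnizD m n (X Y : 'M[B]_(m, n)) :
  map_mx D (X + Y) = map_mx D X + map_mx D Y.
Proof. by apply/matrixP => i j; rewrite !mxE DD. Qed.

Lemma map_LeibnizZ m n x (Y : 'M[B]_(m, n)) :
  map_mx D (x *: Y) = D x *: Y + x *: map_mx D Y.
Proof. by apply/matrixP => i j; rewrite !mxE DM. Qed.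

Lemma map_Leibniz1 n : map_mx D (1%:M : 'M[B]_n) = 0.
Proof.
by apply/matrixP => i j; rewrite !mxE; case: (_ == _); rewrite ?Leibniz1 ?Leibniz0.
Qed.

Lemma map_Leibniz_sum m n (I : Type) (s : seq I) (P : pred I)
    (F : I -> 'M[B]_(m, n)) :
  map_mx D (\sum_(i <- s | P i) F i) = \sum_(i <- s | P i) map_mx D (F i).
Proof.
apply: (big_morph _ (@map_LeibnizD m n)).
by apply/matrixP => i j; rewrite !mxE Leibniz0.
Qed.

End MatrixDerivation.

(** * Exponentials of nilpotent matrices *)

Section Exponential.
Variables (K : fieldType) (n : nat).
Hypothesis K0 : forall k, k.+1%:R != 0 :> K.
Variable N : 'M[K]_n.
Variable m : nat.
Hypothesis Nm : N ^+ m = 0.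

Definition divpow (t : K) (k : nat) : 'M[K]_n := (t ^+ k / k`!%:R) *: N ^+ k.

(** The two terms beyond [m] vanish. They leave room for shifting the index by one and by two
    without changing the sum. *)
Definition mxexp t : 'M[K]_n := \sum_(k < m.+2) divpow t k.

Lemma fact_neq0 k : k`!%:R != 0 :> K.
Proof. by case: k`! (fact_gt0 k) => // j _; exact: K0. Qed.

Lemma divpowS t k : k.+1%:R *: divpow t k.+1 = t *: (N *m divpow t k).
Proof.
rewrite /divpow -scalemxAr !scalerA mulmxE -exprS; congr (_ *: _).
rewrite exprS factS natrM.
move: (k.+1%:R) (K0 k) (k`!%:R) (fact_neq0 k) => a a0 b b0.
by field; rewrite b0 a0.
Qed.

Lemma divpow0 t : divpow t 0 = 1%:M.
Proof. by rewrite /divpow expr0 divr1 scale1r. Qed.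

Lemma divpow_big t k : (m <= k)%N -> divpow t k = 0.
Proof.
by move=> mk; rewrite /divpow -[in N ^+ k](subnK mk) exprD Nm mulr0 scaler0.
Qed.

Definition shift1 (u : nat -> 'M[K]_n) k := if k is j.+1 then u j else 0.

Lemma mxexp_shift1 t : \sum_(k < m.+2) shift1 (divpow t) k = mxexp t.
Proof.
rewrite big_ord_recl /= add0r /mxexp [RHS]big_ord_recr /= (divpow_big t (leqnSn m)).
by rewrite addr0.
Qed.

Lemma mxexp_shift2 t : \sum_(k < m.+2) shift1 (shift1 (divpow t)) k = mxexp t.
Proof.
rewrite big_ord_recl /= add0r big_ord_recl /= add0r.
rewrite /mxexp !big_ord_recr /= (divpow_big t (leqnSn m)) (divpow_big t (leqnn m)).
by rewrite !addr0.
Qed.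

(** Here Y1 = [N, Y0], Y2 = [N, Y1] and [N, Y2] = 0, so the binomial expansion of ad N stops at
    order two. [shift1] supplies the value 0 at negative indices. *)
Lemma divpow_conj t (u : nat -> 'M[K]_n) (Y0 Y1 Y2 : 'M[K]_n) :
  u 0 = 1%:M -> (forall k, k.+1%:R *: u k.+1 = t *: (N *m u k)) ->
  N *m Y0 = Y0 *m N + Y1 -> N *m Y1 = Y1 *m N + Y2 -> N *m Y2 = Y2 *m N ->
  forall k, u k *m Y0 = Y0 *m u k + t *: (Y1 *m shift1 u k)
    + (t ^+ 2 / 2%:R) *: (Y2 *m shift1 (shift1 u) k).
Proof.
move=> u0 uS c0 c1 c2; elim=> [|k IH].
  by rewrite /= !mulmx0 !scaler0 !addr0 u0 mul1mx mulmx1.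
apply: (scalerI (K0 k)).
rewrite [LHS]scalemxAl uS -[LHS]scalemxAl -mulmxA IH !mulmxDr.
rewrite -!scalemxAr !mulmxA c0 c1 c2 !mulmxDl -!mulmxA.
(* The recurrence with its index lowered by one, then by two. The coefficient k - 1 is harmless at k
   = 0, where [shift1 u 0] is zero. *)
have s1 : t *: (N *m shift1 u k) = k%:R *: u k.
  by case: k {IH} => [|k] /=; rewrite ?mulmx0 ?scaler0 ?scale0r ?uS.
have s2 : t *: (N *m shift1 (shift1 u) k) = (k%:R - 1) *: shift1 u k.
  case: k {IH s1} => [|[|k]] /=; first by rewrite mulmx0 !scaler0.
    by rewrite mulmx0 scaler0 subrr scale0r.
  by rewrite -uS -[k.+2]addn1 natrD addrK.
have s0 := uS k.
rewrite !scalerDr [k.+1%:R *: (Y0 *m _)]scalemxAr s0 -[in RHS]scalemxAr.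
rewrite ![t *: (t *: _)]scalerA ![k.+1%:R *: (_ *: _)]scalerA.
have e1 : (t * t) *: (Y1 *m (N *m shift1 u k)) = (t * k%:R) *: (Y1 *m u k).
  by rewrite -scalerA [t *: (Y1 *m _)]scalemxAr s1 -scalemxAr scalerA.
have e2 : (t * (t ^+ 2 / 2%:R)) *: (Y2 *m (N *m shift1 (shift1 u) k))
    = (t ^+ 2 / 2%:R * (k%:R - 1)) *: (Y2 *m shift1 u k).
  by rewrite [t * (_ / _)]mulrC -[LHS]scalerA [t *: (Y2 *m _)]scalemxAr s2 -scalemxAr scalerA.
rewrite !scalerA e1 e2 /= -!addrA; congr (_ + _).
rewrite !addrA -scalerDl -!addrA -!scalerDl; congr (_ *: _ + _ *: _).
  by rewrite -natr1; ring.
by rewrite -natr1; have := K0 1 => h2; field; exact: h2.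
Qed.

(** This is Ad(exp tN) = exp(t ad N) on an element killed by the third power of ad N. *)
Lemma mxexp_conj t (Y0 Y1 Y2 : 'M[K]_n) :
  N *m Y0 = Y0 *m N + Y1 -> N *m Y1 = Y1 *m N + Y2 -> N *m Y2 = Y2 *m N ->
  mxexp t *m Y0 = (Y0 + t *: Y1 + (t ^+ 2 / 2%:R) *: Y2) *m mxexp t.
Proof.
move=> c0 c1 c2.
have step := divpow_conj (divpow0 t) (divpowS t) c0 c1 c2.
rewrite /mxexp mulmx_suml (eq_bigr _ (fun (k : 'I_m.+2) _ => step k)).
rewrite !big_split /= -!scaler_sumr -!mulmx_sumr mxexp_shift1 mxexp_shift2.
by rewrite !mulmxDl -!scalemxAl.
Qed.

(** The exponential is 1 + N S with S commuting with N; so N S is nilpotent and a finite geometric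
    series is the inverse. *)
Lemma mxexp_unit t : mxexp t \in unitmx.
Proof.
pose S := \sum_(k < m.+1) (t ^+ k.+1 / (k.+1)`!%:R) *: N ^+ k.
have eS : mxexp t = 1 + N * S.
  rewrite /mxexp big_ord_recl /= {1}/divpow expr0 fact0 divr1 scale1r; congr (_ + _).
  rewrite /S -mulmxE mulmx_sumr; apply: eq_bigr => k _.
  by rewrite /divpow /= -scalemxAr mulmxE -exprS.
have cNS : GRing.comm N S.
  rewrite /GRing.comm -mulmxE mulmx_sumr mulmx_suml; apply: eq_bigr => k _.
  by rewrite -scalemxAr -scalemxAl !mulmxE -exprS -exprSr.
have nil : (- (N * S)) ^+ m = 0 by rewrite exprNn (exprMn_comm _ cNS) Nm mul0r mulr0.
have := subrX1 (- (N * S)) m; rewrite nil sub0r => h.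
have : mxexp t *m (\sum_(i < m) (- (N * S)) ^+ i) = 1%:M.
  apply: oppr_inj; rewrite -[RHS]/(- 1) h -mulNmx eS opprD mulmxE.
  by rewrite addrC.
by move=> /mulmx1_unit[].
Qed.

Lemma map_mxexp (D : K -> K) t :
  (forall x y, D (x + y) = D x + D y) ->
  (forall x y, D (x * y) = D x * y + x * D y) ->
  map_mx D N = 0 -> map_mx D (mxexp t) = D t *: (mxexp t *m N).
Proof.
move=> DD DM DN.
have DNk k : map_mx D (N ^+ k) = 0.
  elim: k => [|k IH]; first exact: map_Leibniz1.
  by rewrite exprS -mulmxE map_LeibnizM // IH DN mul0mx mulmx0 addr0.
have Dc k : D (k%:R) = 0.
  by elim: k => [|k IH]; rewrite ?Leibniz0 // -natr1 DD IH Leibniz1 // addr0.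
rewrite /mxexp map_Leibniz_sum // big_ord_recl /= {1}/divpow expr0 fact0 divr1 scale1r.
rewrite map_Leibniz1 // add0r.
rewrite [X in X *m N]big_ord_recr /= divpow_big // addr0 mulmx_suml scaler_sumr.
apply: eq_bigr => k _; rewrite /bump leq0n add1n /divpow map_LeibnizZ // DNk scaler0 addr0.
rewrite -scalemxAl mulmxE -exprSr scalerA; congr (_ *: _).
have h2 := K0 k; have h1 := fact_neq0 k.
(* Differentiating this product replaces a quotient rule, since D vanishes on natural numbers. *)
have e : t ^+ k.+1 / (k.+1)`!%:R * (k.+1)`!%:R = t ^+ k.+1.
  by rewrite divfK // fact_neq0.
have := congr1 D e; rewrite DM Dc mulr0 addr0 LeibnizX //= => e2.
apply: (mulIf (fact_neq0 k.+1)); rewrite e2 factS natrM.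
by field; rewrite h1.
Qed.

End Exponential.

(** * Generation of SL by transvections *)

Section SLGeneration.
Variable K : fieldType.

Lemma delta_mx_dlshift m (i : 'I_m) :
  delta_mx (rshift 1 i) (lshift m 0) = block_mx 0 0 (delta_mx i 0) 0 :> 'M[K]_(1 + m).
Proof.
apply/matrixP => k l; case: (split_ordP k) => k' ->; case: (split_ordP l) => l' ->;
  by rewrite ?(block_mxEul, block_mxEur, block_mxEdl, block_mxEdr) !mxE !eq_shift ?andbF.
Qed.

Lemma delta_mx_drshift m (i j : 'I_m) :
  delta_mx (rshift 1 i) (rshift 1 j) = block_mx 0 0 0 (delta_mx i j) :> 'M[K]_(1 + m).
Proof.
apply/matrixP => k l; case: (split_ordP k) => k' ->; case: (split_ordP l) => l' ->;
  by rewrite ?(block_mxEul, block_mxEur, block_mxEdl, block_mxEdr) !mxE !eq_shift ?andbF.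
Qed.

(** The blocks [L w] multiply as their columns add, so multiples of basis columns suffice, and these
    give transvections. *)
Lemma lower_transvections m (P : 'M[K]_(1 + m) -> Prop) :
  (forall g h, P g -> P h -> P (g *m h)) ->
  (forall i j t, i != j -> P (1%:M + t *: delta_mx i j)) -> P 1%:M ->
  forall v : 'cV[K]_m, P (block_mx 1%:M 0 v 1%:M).
Proof.
move=> PM Pt P1 v; pose L (w : 'cV[K]_m) : 'M_(1 + m) := block_mx 1%:M 0 w 1%:M.
have LD w w' : L w *m L w' = L (w + w').
  by rewrite /L mulmx_block !mul1mx !mulmx1 !mul0mx !mulmx0 !addr0 add0r addrC.
rewrite -/(L v) [v]matrix_sum_delta.
apply: (big_ind (fun w => P (L w))).
- by rewrite /L -scalar_mx_block.
- by move=> w w'; rewrite -LD; apply: PM.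
move=> i _; rewrite big_ord1.
have -> : L (v i 0 *: delta_mx i 0) =
    1%:M + v i 0 *: delta_mx (rshift 1 i) (lshift m 0).
  rewrite delta_mx_dlshift /L (scalar_mx_block 1 m) scale_block_mx add_block_mx.
  by rewrite !scaler0 !addr0 add0r.
by apply: Pt; rewrite eq_rlshift.
Qed.

Lemma upper_transvections m (P : 'M[K]_(1 + m) -> Prop) :
  (forall g h, P g -> P h -> P (g *m h)) ->
  (forall i j t, i != j -> P (1%:M + t *: delta_mx i j)) -> P 1%:M ->
  forall v : 'rV[K]_m, P (block_mx 1%:M v 0 1%:M).
Proof.
move=> PM Pt P1 v; pose Q (g : 'M[K]_(1 + m)) := P g^T.
have := @lower_transvections m Q; rewrite /Q => /(_ _ _ _ v^T).
rewrite tr_block_mx !trmx1 trmx0 trmxK; apply.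
- by move=> g h Pg Ph; rewrite trmx_mul; apply: PM.
- by move=> i j t ij; rewrite linearD linearZ /= trmx1 trmx_delta; apply: Pt; rewrite eq_sym.
- by rewrite ?trmx1.
Qed.

Lemma lift0_mxM m (A B : 'M[K]_m) :
  lift0_mx (A *m B) = lift0_mx A *m lift0_mx B :> 'M_(1 + m).
Proof.
by rewrite /lift0_mx mulmx_block !(mul1mx, mulmx1, mul0mx, mulmx0, addr0, add0r).
Qed.

Lemma lift0_mx_transvection m (i j : 'I_m) (t : K) :
  lift0_mx (1%:M + t *: delta_mx i j) =
  1%:M + t *: delta_mx (rshift 1 i) (rshift 1 j) :> 'M_(1 + m).
Proof.
rewrite delta_mx_drshift /lift0_mx (scalar_mx_block 1 m).
by rewrite scale_block_mx add_block_mx !scaler0 !addr0.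
Qed.

(** Gaussian elimination that never rescales a row: once the corner entry is 1, the Schur complement
    again has determinant 1 and the induction applies to it. *)
Lemma SL_ind m (P : 'M[K]_m -> Prop) :
  (forall g h, P g -> P h -> P (g *m h)) ->
  (forall i j t, i != j -> P (1%:M + t *: delta_mx i j)) -> P 1%:M ->
  forall g, \det g = 1 -> P g.
Proof.
elim: m P => [|m IH] P PM Pt P1 g dg; first by rewrite flatmx0 -(flatmx0 1%:M).
have pivot (h : 'M[K]_(1 + m)) : h 0 0 = 1 -> \det h = 1 -> P h.
  move=> h00 dh.
  pose u := ursubmx h; pose v := dlsubmx h; pose A := drsubmx h - v *m u.
  have ul : ulsubmx h = 1%:M.
    apply/matrixP => i j; rewrite !ord1 !mxE /= -[RHS]h00.
    by congr (h _ _); apply: val_inj.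
  have eh : h = block_mx 1%:M 0 v 1%:M *m lift0_mx A *m block_mx 1%:M u 0 1%:M.
    rewrite /lift0_mx !mulmx_block !(mul1mx, mulmx1, mul0mx, mulmx0, addr0, add0r).
    by rewrite /A addrC subrK -[LHS]submxK ul.
  rewrite eh; apply: (PM); first apply: (PM).
  - exact: lower_transvections.
  - apply: (IH (fun B => P (lift0_mx B))).
    + by move=> B B' PB PB'; rewrite lift0_mxM; apply: PM.
    + by move=> i j t ij; rewrite lift0_mx_transvection; apply: Pt; rewrite -(eq_rshift 1) in ij.
    + by rewrite /lift0_mx -scalar_mx_block.
    + move: dh; rewrite eh !det_mulmx /lift0_mx det_lblock det_ublock.
      by rewrite det_ublock !det1 !mul1r mulr1.
  - exact: upper_transvections.
have det_t (i j : 'I_m.+1) (t : K) : i != j -> \det (1%:M + t *: delta_mx i j) = 1.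
  move=> ij; wlog lt_ij : i j ij / (i < j)%N => [hw|].
    case: (ltngtP i j) => [lt_ij|lt_ji|/val_inj e]; first exact: hw.
      rewrite -det_tr linearD linearZ /= trmx1 trmx_delta hw // eq_sym //.
    by rewrite e eqxx in ij.
  rewrite -det_tr det_trig.
    rewrite big1 // => k _; rewrite !mxE eqxx.
    by case: (k =P i) => [->|]; rewrite ?(negPf ij) /= ?mulr0 ?addr0.
  apply/is_trig_mxP => k l kl; rewrite !mxE.
  have -> : (l == k :> 'I_m.+1) = false by apply/eqP => e; rewrite e ltnn in kl.
  case: (l =P i) => [li|]; case: (k =P j) => [kj|]; rewrite /= ?mulr0 ?addr0 //.
  by move: kl; rewrite li kj ltnNge ltnW.
have tK (i j : 'I_m.+1) (t : K) : i != j ->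
    (1%:M - t *: delta_mx i j) *m (1%:M + t *: delta_mx i j) = 1%:M :> 'M_m.+1.
  move=> ij; rewrite mulmxBl !mulmxDr !mulmx1 !mul1mx -scalemxAl -scalemxAr.
  by rewrite mul_delta_mx_0 1?eq_sym // !scaler0 addr0 addrK.
(* Adding t times row i to row 0 turns the corner into h 0 0 + t h i 0 = 1; the inverse transvection
   undoes this. *)
have col (h : 'M[K]_(1 + m)) (i : 'I_m.+1) : i != 0 -> h i 0 != 0 -> \det h = 1 -> P h.
  move=> i0 hi0 dh; pose t := (1 - h 0 0) / h i 0.
  have i0' : 0 != i by rewrite eq_sym.
  rewrite -[h]mul1mx -(tK 0 i t i0') -mulmxA; apply: (PM).
    by rewrite -scaleNr; apply: Pt.
  apply: pivot; last by rewrite det_mulmx det_t // mul1r.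
  rewrite mulmxDl mul1mx -scalemxAl mxE [X in _ + X]mxE [X in _ * X]mxE.
  rewrite (bigD1 i) //= big1 => [|k ki]; last by rewrite mxE (negPf ki) andbF mul0r.
  by rewrite mxE !eqxx mul1r addr0 /t divfK // addrC subrK.
have [/existsP[i /andP[i0 gi0]]|/existsPn none] :=
    boolP [exists i : 'I_m.+1, (i != 0) && (g i 0 != 0)]; first exact: (col g i).
have g0 i : i != 0 -> g i 0 = 0.
  by move=> i0; move: (none i); rewrite i0 /= negbK => /eqP.
(* The first column now vanishes below the corner. In size one the determinant is the corner itself;
   otherwise row 0 is added to row 1 to create a nonzero entry below it. *)
case: m => [|m] in g dg IH P PM Pt P1 pivot det_t tK col none g0 *.
  by apply: pivot => //; rewrite -det_mx11.
pose i1 : 'I_m.+2 := lift 0 0.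
have i10 : i1 != 0 by [].
have g00 : g 0 0 != 0.
  apply/eqP => g00; move: dg; rewrite (expand_det_col _ 0) big1 => [|i _].
    by move/eqP; rewrite eq_sym oner_eq0.
  by case: (eqVneq i 0) => [->|/g0 ->]; rewrite ?g00 mul0r.
rewrite -[g]mul1mx -(tK i1 0 1 i10) -mulmxA; apply: (PM).
  by rewrite -scaleNr; apply: Pt.
apply: (col _ i1) => //; last by rewrite det_mulmx det_t // mul1r.
rewrite mulmxDl mul1mx scale1r mxE [X in _ + X]mxE g0 // add0r.
rewrite (bigD1 0) //= big1 => [|k ki]; last by rewrite mxE (negPf ki) andbF mul0r.
by rewrite mxE !eqxx mul1r addr0.
Qed.

End SLGeneration.

(** * Integrating representations of gl_r over a field extension *)

Definition derivation_over (C B : comNzRingType) (iota : C -> B) (D : B -> B) : Prop :=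
  [/\ forall x y, D (x + y) = D x + D y,
      forall x y, D (x * y) = D x * y + x * D y
    & forall c, D (iota c) = 0].

(** The commutators of matrix units, [E_ij, E_kl] = delta_jk E_il - delta_li E_kj, with [rho i j] as
    the image of E_ij. *)
Definition gl_rep (C : comNzRingType) (r n : nat) (rho : 'I_r -> 'I_r -> 'M[C]_n) : Prop :=
  forall i j k l, rho i j *m rho k l - rho k l *m rho i j
    = (j == k)%:R *: rho i l - (l == i)%:R *: rho k j.

Lemma mx_delta_ind (K : pzRingType) m n (P : 'M[K]_(m, n) -> Prop) :
  P 0 -> (forall X Y, P X -> P Y -> P (X + Y)) -> (forall a X, P X -> P (a *: X)) ->
  (forall i j, P (delta_mx i j)) -> forall X, P X.
Proof.
move=> P0 PD PZ Pd X; rewrite [X]matrix_sum_delta.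
by apply: big_ind => // i _; apply: big_ind => // j _; apply: PZ.
Qed.

Section Integration.
Variables (C : numFieldType) (K : fieldType) (iota : {rmorphism C -> K}).
Variables (r n : nat) (rho : 'I_r -> 'I_r -> 'M[C]_n).
Hypothesis rho_rep : gl_rep rho.

Definition rep_ext (X : 'M[K]_r) : 'M[K]_n :=
  \sum_i \sum_j X i j *: map_mx iota (rho i j).

Lemma rep_ext_is_linear : linear rep_ext.
Proof.
move=> a X Y; rewrite /rep_ext scaler_sumr -big_split; apply: eq_bigr => i _ /=.
rewrite scaler_sumr -big_split; apply: eq_bigr => j _ /=.
by rewrite !mxE scalerDl scalerA.
Qed.

HB.instance Definition _ :=
  GRing.isLinear.Build K 'M[K]_r 'M[K]_n _ rep_ext rep_ext_is_linear.

Lemma rep_ext_delta i j : rep_ext (delta_mx i j) = map_mx iota (rho i j).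
Proof.
rewrite /rep_ext (bigD1 i) //= (bigD1 j) //= mxE !eqxx scale1r.
rewrite big1 => [|k kj]; last by rewrite mxE (negPf kj) andbF scale0r.
rewrite big1 => [|k ki]; first by rewrite !addr0.
by rewrite big1 // => l _; rewrite mxE (negPf ki) scale0r.
Qed.

Lemma rep_ext_lie X Y :
  rep_ext X *m rep_ext Y - rep_ext Y *m rep_ext X = rep_ext (X *m Y - Y *m X).
Proof.
have dd i j k l : rep_ext (delta_mx i j) *m rep_ext (delta_mx k l)
   - rep_ext (delta_mx k l) *m rep_ext (delta_mx i j)
   = rep_ext (delta_mx i j *m delta_mx k l - delta_mx k l *m delta_mx i j).
  rewrite !mul_delta_mx_cond -!scaler_nat linearB !linearZ /= !rep_ext_delta.
  by rewrite -!map_mxM -map_mxB rho_rep map_mxB !map_mxZ !rmorph_nat scalerN.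
move: X; apply: mx_delta_ind => [|X X' h h'|a X h|i j].
- by rewrite linear0 !mul0mx !mulmx0 !subrr linear0.
- by rewrite [rep_ext (X + _)]linearD !mulmxDl !mulmxDr !opprD addrACA h h' -linearD addrACA.
- by rewrite [rep_ext (a *: X)]linearZ -!scalemxAl -!scalemxAr -!scalerBr h -linearZ.
move: Y; apply: mx_delta_ind => [|Y Y' h h'|a Y h|k l]; last exact: dd.
- by rewrite linear0 !mul0mx !mulmx0 !subrr linear0.
- by rewrite [rep_ext (Y + _)]linearD !mulmxDl !mulmxDr !opprD addrACA h h' -linearD addrACA.
- by rewrite [rep_ext (a *: Y)]linearZ -!scalemxAl -!scalemxAr -!scalerBr h -linearZ.
Qed.

Lemma rep_ext_nilpotent i j : i != j -> exists m, rep_ext (delta_mx i j) ^+ m = 0.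
Proof.
move=> ij; have ji : (j == i) = false by rewrite eq_sym; exact: negPf ij.
have [|m hm] := @ad_eigen_nilpotent C n (rho i i - rho j j) (rho i j).
  have h1 : rho i i *m rho i j - rho i j *m rho i i = rho i j.
    by rewrite rho_rep eqxx ji scale1r scale0r subr0.
  have h2 : rho i j *m rho j j - rho j j *m rho i j = rho i j.
    by rewrite rho_rep eqxx ji scale1r scale0r subr0.
  rewrite mulmxBl mulmxBr opprD opprK addrACA h1 [- _ + _]addrC h2.
  by rewrite scaler_nat mulr2n.
exists m; rewrite rep_ext_delta.
have -> : map_mx iota (rho i j) ^+ m = map_mx iota (rho i j ^+ m).
  elim: m {hm} => [|m IH]; first by rewrite !expr0 map_mx1.
  by rewrite !exprS IH -!mulmxE map_mxM.
by rewrite hm map_mx0.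
Qed.

(** [G] plays the role of the group representation at [g]. The intertwining clause is carried along
    because the logarithmic derivative of a product g h contains h^-1 (g^-1 Dg) h: without it, the
    derivative clause could not be multiplied. *)
Definition integrates (g : 'M[K]_r) (G : 'M[K]_n) : Prop :=
  [/\ G \in unitmx,
      forall X, G *m rep_ext X = rep_ext (g *m X *m invmx g) *m G
    & forall D, derivation_over iota D ->
        map_mx D G = G *m rep_ext (invmx g *m map_mx D g)].

Definition integrable g := g \in unitmx /\ exists G, integrates g G.

Lemma invmxM (m : nat) (g h : 'M[K]_m) : g \in unitmx -> h \in unitmx ->
  invmx (g *m h) = invmx h *m invmx g.
Proof.
move=> gu hu; have ghu : g *m h \in unitmx by rewrite unitmx_mul gu.
apply: (can_inj (mulKmx ghu)); rewrite mulmxV // mulmxA -[g *m h *m _]mulmxA.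
by rewrite mulmxV // mulmx1 mulmxV.
Qed.

Lemma integrable_mul g h : integrable g -> integrable h -> integrable (g *m h).
Proof.
move=> [gu [G [Gu GA GD]]] [hu [H [Hu HA HD]]].
split; first by rewrite unitmx_mul gu.
exists (G *m H); split; first by rewrite unitmx_mul Gu.
  by move=> X; rewrite -mulmxA HA mulmxA GA invmxM // !mulmxA.
move=> D dD; have [DD DM _] := dD.
rewrite map_LeibnizM // GD // HD // -!mulmxA -mulmxDr; congr (_ *m _).
rewrite map_LeibnizM // mulmxDr linearD /= mulmxDr invmxM //; congr (_ + _).
  rewrite HA; congr (rep_ext _ *m _).
  by rewrite !mulmxA mulmxV // mul1mx -!mulmxA mulmxV // mulmx1.
by rewrite -!mulmxA mulKmx.
Qed.

Lemma integrable1 : integrable 1%:M.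
Proof.
split; first exact: unitmx1.
exists 1%:M; split; first exact: unitmx1.
  by move=> X; rewrite mul1mx invmx1 !mulmx1 mul1mx.
by move=> D [DD DM _]; rewrite !map_Leibniz1 // mulmx0 linear0 mulmx0.
Qed.

Lemma natK_neq0 k : k.+1%:R != 0 :> K.
Proof. by rewrite -(rmorph_nat iota) fmorph_eq0 pnatr_eq0. Qed.

Lemma integrable_transvection i j t : i != j -> integrable (1%:M + t *: delta_mx i j).
Proof.
move=> ij; set E := delta_mx i j.
have EE : E *m E = 0 by rewrite mul_delta_mx_0 // eq_sym.
have [m Nm] := rep_ext_nilpotent ij; rewrite -/E in Nm.
have gK : (1%:M - t *: E) *m (1%:M + t *: E) = 1%:M.
  rewrite mulmxBl !mulmxDr !mulmx1 !mul1mx -scalemxAl -scalemxAr.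
  by rewrite EE !scaler0 addr0 addrK.
have [gu' gu] := mulmx1_unit gK.
have gV : invmx (1%:M + t *: E) = 1%:M - t *: E.
  by apply: (can_inj (mulmxK gu)); rewrite mulVmx.
split=> //; exists (mxexp (rep_ext E) m t); split.
- exact: (mxexp_unit Nm).
(* Since E E = 0, W = [E, [E, X]] is -2 E X E and commutes with E. So ad E has order three on X, and
   the second-order expansion is exactly conjugation by 1 + tE. *)
- move=> X; pose Z := E *m X - X *m E.
  pose W := E *m Z - Z *m E.
  have lie Y : rep_ext E *m rep_ext Y = rep_ext Y *m rep_ext E + rep_ext (E *m Y - Y *m E).
    by rewrite -rep_ext_lie addrC subrK.
  have eW : W = - (2%:R *: (E *m X *m E)).
    rewrite /W /Z mulmxBr mulmxBl !mulmxA EE mul0mx sub0r -[X *m E *m E]mulmxA EE.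
    by rewrite mulmx0 subr0 scaler_nat mulr2n opprD.
  rewrite (mxexp_conj natK_neq0 Nm t (lie X) (lie Z)); last first.
    rewrite lie -/Z -/W eW !(mulmxN, mulNmx) -scalemxAr -scalemxAl !mulmxA EE !mul0mx.
    by rewrite -!mulmxA EE !mulmx0 !scaler0 subrr linear0 addr0.
  congr (_ *m _); rewrite -/Z -/W -!linearZ -!linearD /=; congr (rep_ext _).
  have h2 : 2%:R != 0 :> K by exact: (natK_neq0 1).
  rewrite gV eW /Z scalerN scalerA divfK // mulmxDl mul1mx mulmxBr mulmx1.
  rewrite -[(t *: E) *m X]scalemxAl -[_ *m (t *: E)]scalemxAr mulmxDl.
  rewrite -[(t *: _) *m E]scalemxAl [t *: (X *m E + _)]scalerDr scalerA -expr2 scalerBr opprD.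
  by rewrite !addrA.
- move=> D [DD DM D0]; rewrite (map_mxexp natK_neq0 Nm) //; last first.
    rewrite rep_ext_delta; apply/matrixP => p q; by rewrite !mxE D0.
  rewrite map_LeibnizD // map_Leibniz1 // add0r map_LeibnizZ //.
  have -> : map_mx D E = 0.
    apply/matrixP => p q; rewrite !mxE.
    by case: (_ && _); rewrite ?Leibniz1 ?Leibniz0.
  rewrite scaler0 addr0 gV mulmxBl mul1mx -scalemxAl -scalemxAr EE !scaler0 subr0.
  by rewrite linearZ /= scalemxAr.
Qed.

Lemma SL_integrable g : \det g = 1 -> integrable g.
Proof.
apply: SL_ind; [exact: integrable_mul| |exact: integrable1].
exact: integrable_transvection.
Qed.

Lemma det_one_plus_delta (m : 'I_r) (c : K) : \det (1%:M + c *: delta_mx m m) = 1 + c.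
Proof.
rewrite det_trig; last first.
  apply/is_trig_mxP => k l kl; rewrite !mxE.
  have -> : (k == l) = false by apply/eqP => e; rewrite e ltnn in kl.
  case: (k =P m) => [km|]; case: (l =P m) => [lm|]; rewrite ?mulr0 ?addr0 //.
  by rewrite km lm ltnn in kl.
rewrite (bigD1 m) //= big1 => [|k km]; rewrite !mxE ?eqxx ?mulr1 //.
by rewrite (negPf km) mulr0 addr0.
Qed.

(** The gauge transformation is obtained by integrating rho along
    s^-1 g, where s = diag(1, .., 1, det g). *)
Lemma gl_gauge (m : 'I_r) (g : 'M[K]_r) : g \in unitmx ->
  exists2 G : 'M[K]_n, G \in unitmx & forall D, derivation_over iota D ->
    map_mx D G = G *m rep_ext (invmx g *m map_mx D g)
      - (D (\det g) / \det g) *: (map_mx iota (rho m m) *m G).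
Proof.
move=> gu; set d := \det g.
have d0 : d != 0 by move: gu; rewrite unitmxE unitfE.
pose e : 'M[K]_r := delta_mx m m.
have ee : e *m e = e by rewrite mul_delta_mx.
pose s := 1%:M + (d - 1) *: e; pose sV := 1%:M + (d^-1 - 1) *: e.
have se : s *m e = d *: e.
  by rewrite mulmxDl mul1mx -scalemxAl ee scalerBl scale1r addrC subrK.
have es : e *m s = d *: e.
  by rewrite mulmxDr mulmx1 -scalemxAr ee scalerBl scale1r addrC subrK.
have sVe : sV *m e = d^-1 *: e.
  by rewrite mulmxDl mul1mx -scalemxAl ee scalerBl scale1r addrC subrK.
have sVs : sV *m s = 1%:M.
  rewrite [s]/(1%:M + _) mulmxDr mulmx1 -scalemxAr sVe scalerA /sV -addrA -scalerDl.
  by rewrite (_ : d^-1 - 1 + (d - 1) * d^-1 = 0) ?scale0r ?addr0 //; field.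
have [sVu su] := mulmx1_unit sVs.
have [|g'u [G [Gu GA GD]]] := @SL_integrable (sV *m g).
  by rewrite det_mulmx det_one_plus_delta addrC subrK mulVf.
exists G => // D dD; have [DD DM Dc] := dD.
have inv_g' : invmx (sV *m g) = invmx g *m s.
  rewrite invmxM //; congr (_ *m _).
  by apply: (can_inj (mulKmx sVu)); rewrite mulmxV.
(* Conjugation by sV g sends g^-1 e g to sV e s, which is e again because s commutes with e. *)
have GAe : G *m rep_ext (invmx g *m e *m g) = map_mx iota (rho m m) *m G.
  rewrite GA -rep_ext_delta; congr (rep_ext _ *m _).
  rewrite inv_g' !mulmxA -[sV *m g *m _]mulmxA mulmxV // mulmx1.
  rewrite -[sV *m e *m _ *m _]mulmxA mulmxV // mulmx1 sVe -scalemxAl es scalerA.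
  by rewrite mulVf // scale1r.
(* The logarithmic derivative of sV g is g^-1 Dg plus g^-1 s (D sV) g = -(Dd / d) g^-1 e g; [GAe]
   turns the second term into the correction by rho(E_mm). *)
rewrite GD // map_LeibnizM // mulmxDr.
have DsV : map_mx D sV = (- (D d / d ^+ 2)) *: e.
  rewrite map_LeibnizD // map_Leibniz1 // add0r map_LeibnizZ //.
  have -> : map_mx D e = 0.
    apply/matrixP => p q; rewrite !mxE.
    by case: (_ && _); rewrite ?Leibniz1 ?Leibniz0.
  rewrite scaler0 addr0 DD LeibnizN // Leibniz1 // oppr0 addr0; congr (_ *: _).
  have : D (d * d^-1) = 0 by rewrite mulfV // Leibniz1.
  rewrite DM => /eqP; rewrite addrC addr_eq0 => /eqP h.
  by apply: (mulfI d0); rewrite h; field.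
rewrite DsV inv_g' -scalemxAl -scalemxAr -[_ *m s *m _]mulmxA [s *m (e *m g)]mulmxA se.
rewrite -scalemxAl -scalemxAr scalerA.
have -> : - (D d / d ^+ 2) * d = - (D d / d) by field.
rewrite -[invmx g *m s *m _]mulmxA [s *m (sV *m _)]mulmxA (mulmx1C sVs) mul1mx.
rewrite linearD linearZ /= mulmxDr addrC; congr (_ + _).
by rewrite -scalemxAr mulmxA GAe scaleNr.
Qed.

End Integration.

(** * Regular functions and derivations on GL_r *)

Section RegularFunctions.
Variable C : fieldType.

Lemma fun_sum_closed T (Q : (T -> C) -> Prop) (I : Type) (s : seq I) (P : pred I)
    (F : I -> T -> C) :
  Q (fun=> 0) -> (forall f g, Q f -> Q g -> Q (fun x => f x + g x)) ->
  (forall i, Q (F i)) -> Q (fun x => \sum_(i <- s | P i) F i x).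
Proof.
move=> Q0 QD QF; elim: s => [|i s IH].
  by rewrite (_ : (fun _ => _) = fun=> 0) //; apply/funext => x; rewrite big_nil.
case Pi: (P i).
  rewrite (_ : (fun _ => _) = fun x => F i x + \sum_(j <- s | P j) F j x); first exact: QD.
  by apply/funext => x; rewrite big_cons Pi.
by rewrite (_ : (fun _ => _) = fun x => \sum_(j <- s | P j) F j x) //;
  apply/funext => x; rewrite big_cons Pi.
Qed.

Lemma fun_prod_closed T (Q : (T -> C) -> Prop) (I : Type) (s : seq I) (P : pred I)
    (F : I -> T -> C) :
  Q (fun=> 1) -> (forall f g, Q f -> Q g -> Q (fun x => f x * g x)) ->
  (forall i, Q (F i)) -> Q (fun x => \prod_(i <- s | P i) F i x).
Proof.
move=> Q1 QM QF; elim: s => [|i s IH].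
  by rewrite (_ : (fun _ => _) = fun=> 1) //; apply/funext => x; rewrite big_nil.
case Pi: (P i).
  rewrite (_ : (fun _ => _) = fun x => F i x * \prod_(j <- s | P j) F j x); first exact: QM.
  by apply/funext => x; rewrite big_cons Pi.
by rewrite (_ : (fun _ => _) = fun x => \prod_(j <- s | P j) F j x) //;
  apply/funext => x; rewrite big_cons Pi.
Qed.

Section PolynomialFunctions.
Variable r : nat.
Implicit Types P Q : 'M[C]_r -> C.

Lemma polyfun_exp P k : is_polyfun P -> is_polyfun (fun A => P A ^+ k).
Proof.
move=> pP; elim: k => [|k IH]; first exact: (pf_const _ 1).
by rewrite (_ : (fun _ => _) = fun A => P A * P A ^+ k); [exact: pf_mul|
  apply/funext => A; rewrite exprS].
Qed.

Lemma polyfun_det : is_polyfun (fun A : 'M[C]_r => \det A).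
Proof.
apply: fun_sum_closed => [|f g pf pg|s]; [exact: pf_const|exact: pf_add|].
apply: (pf_mul (f := fun=> _)); first exact: pf_const.
apply: fun_prod_closed => [|f g pf pg|i]; [exact: pf_const|exact: pf_mul|].
exact: pf_coord.
Qed.

Lemma det_neq0 (x : GLpt C r) : \det (val x) != 0.
Proof. by case: x => x /=; rewrite unitmxE unitfE. Qed.

Lemma polyfun_regular P : is_polyfun P -> regular (fun x : GLpt C r => P (val x)).
Proof. by move=> pP; exists P, 0 => //; split=> // x; rewrite expr0 divr1. Qed.

Lemma regular_const c : regular (fun _ : GLpt C r => c).
Proof. exact: (polyfun_regular (pf_const r c)). Qed.

Lemma regular_coord i j : regular (fun x : GLpt C r => val x i j).
Proof. exact: (polyfun_regular (pf_coord C i j)). Qed.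

Lemma regular_add (f g : GLpt C r -> C) :
  regular f -> regular g -> regular (fun x => f x + g x).
Proof.
move=> [P [k [pP eP]]] [Q [l [pQ eQ]]].
exists (fun A => P A * \det A ^+ l + Q A * \det A ^+ k), (k + l)%N; split.
  by apply: pf_add; apply: pf_mul => //; apply: polyfun_exp polyfun_det.
move=> x; rewrite eP eQ exprD.
have a0 := expf_neq0 k (det_neq0 x); have b0 := expf_neq0 l (det_neq0 x).
by field; rewrite a0 b0.
Qed.

Lemma regular_mul (f g : GLpt C r -> C) :
  regular f -> regular g -> regular (fun x => f x * g x).
Proof.
move=> [P [k [pP eP]]] [Q [l [pQ eQ]]].
exists (fun A => P A * Q A), (k + l)%N; split; first exact: pf_mul.
move=> x; rewrite eP eQ exprD.
have a0 := expf_neq0 k (det_neq0 x); have b0 := expf_neq0 l (det_neq0 x).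
by field; rewrite a0 b0.
Qed.

Lemma regular_sum (I : Type) (s : seq I) (P : pred I) (F : I -> GLpt C r -> C) :
  (forall i, regular (F i)) -> regular (fun x => \sum_(i <- s | P i) F i x).
Proof.
by apply: fun_sum_closed => [|f g]; [exact: regular_const|exact: regular_add].
Qed.

Lemma regular_exp (f : GLpt C r -> C) k : regular f -> regular (fun x => f x ^+ k).
Proof.
move=> rf; elim: k => [|k IH]; first exact: (regular_const 1).
by rewrite (_ : (fun _ => _) = fun x => f x * f x ^+ k); [exact: regular_mul|
  apply/funext => x; rewrite exprS].
Qed.

Lemma regular_det : regular (fun x : GLpt C r => \det (val x)).
Proof. exact: polyfun_regular polyfun_det. Qed.

Lemma regular_detV : regular (fun x : GLpt C r => (\det (val x))^-1).
Proof.
exists (fun=> 1), 1 => //; split=> [|x]; first exact: pf_const.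
by rewrite expr1 mul1r.
Qed.

Lemma regmx_mul p q s (F : GLpt C r -> 'M[C]_(p, q)) (G : GLpt C r -> 'M[C]_(q, s)) :
  regmx F -> regmx G -> regmx (fun x => F x *m G x).
Proof.
move=> rF rG i j.
rewrite (_ : (fun _ => _) = fun x => \sum_k F x i k * G x k j); last first.
  by apply/funext => x; rewrite mxE.
by apply: regular_sum => k; apply: regular_mul.
Qed.

Lemma regmx_const p q (A : 'M[C]_(p, q)) : regmx (fun _ : GLpt C r => A).
Proof. by move=> i j; exact: regular_const. Qed.

Lemma regmx_add p q (F G : GLpt C r -> 'M[C]_(p, q)) :
  regmx F -> regmx G -> regmx (fun x => F x + G x).
Proof.
move=> rF rG i j; rewrite (_ : (fun _ => _) = fun x => F x i j + G x i j).
  exact: regular_add.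
by apply/funext => x; rewrite mxE.
Qed.

Lemma regmx_scale p q (f : GLpt C r -> C) (F : GLpt C r -> 'M[C]_(p, q)) :
  regular f -> regmx F -> regmx (fun x => f x *: F x).
Proof.
move=> rf rF i j; rewrite (_ : (fun _ => _) = fun x => f x * F x i j).
  exact: regular_mul.
by apply/funext => x; rewrite mxE.
Qed.

Lemma regmx_val : regmx (fun x : GLpt C r => val x).
Proof. exact: regular_coord. Qed.

Lemma regmx_inv : regmx (fun x : GLpt C r => invmx (val x)).
Proof.
move=> i j; rewrite (_ : (fun _ => _) =
    fun x : GLpt C r => (\det (val x))^-1 * \adj (val x) i j); last first.
  by apply/funext => -[x xu]; rewrite /invmx xu mxE.
apply: regular_mul; first exact: regular_detV.
apply: (@polyfun_regular (fun A => \adj A i j)).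
rewrite (_ : (fun _ => _) = fun A : 'M[C]_r => cofactor A j i); last first.
  by apply/funext => A; rewrite mxE.
apply: (pf_mul (f := fun=> _)); first exact: pf_const.
apply: fun_sum_closed => [|f g pf pg|s]; [exact: pf_const|exact: pf_add|].
apply: (pf_mul (f := fun=> _)); first exact: pf_const.
apply: fun_prod_closed => [|f g pf pg|k]; [exact: pf_const|exact: pf_mul|].
rewrite (_ : (fun _ => _) = fun A : 'M[C]_r => A (lift j k) (lift i (s k))).
  exact: pf_coord.
by apply/funext => A; rewrite !mxE.
Qed.

End PolynomialFunctions.

Section Derivations.
Variables (r : nat) (v : vfield C r).
Hypothesis dv : derivation v.

Lemma der_regular f : regular f -> regular (v f).
Proof. by case: dv => + _ _ _; apply. Qed.

Lemma der_add f g x : regular f -> regular g -> v (fun y => f y + g y) x = v f x + v g x.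
Proof. by case: dv => _ + _ _ => h rf rg; rewrite h. Qed.

Lemma der_mul f g x : regular f -> regular g ->
  v (fun y => f y * g y) x = v f x * g x + f x * v g x.
Proof. by case: dv => _ _ _ h rf rg; rewrite h. Qed.

Lemma der_scale c f x : regular f -> v (fun y => c * f y) x = c * v f x.
Proof. by case: dv => _ _ h _ rf; rewrite h. Qed.

Lemma der_const c x : v (fun=> c) x = 0.
Proof.
have v1 : v (fun=> 1) x = 0.
  apply: (addrI (v (fun=> 1) x)); rewrite addr0.
  have := @der_mul _ _ x (regular_const r 1) (regular_const r 1).
  by rewrite !(mulr1, mul1r) => /esym.
have := @der_scale c _ x (regular_const r 1); rewrite v1 mulr0 => <-.
by congr (v _ _); apply/funext => y; rewrite mulr1.
Qed.

Lemma der_sum (I : Type) (s : seq I) (P : pred I) (F : I -> GLpt C r -> C) x :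
  (forall i, regular (F i)) ->
  v (fun y => \sum_(i <- s | P i) F i y) x = \sum_(i <- s | P i) v (F i) x.
Proof.
move=> rF; elim: s => [|i s IH].
  rewrite [RHS]big_nil -[RHS](der_const 0 x); congr (v _ _).
  by apply/funext => y; rewrite big_nil.
rewrite big_cons; case Pi: (P i); last first.
  by rewrite -IH; congr (v _ _); apply/funext => y; rewrite big_cons Pi.
rewrite -IH -der_add //; last exact: regular_sum.
by congr (v _ _); apply/funext => y; rewrite big_cons Pi.
Qed.

Lemma Dmx_mul p q s (F : GLpt C r -> 'M[C]_(p, q)) (G : GLpt C r -> 'M[C]_(q, s)) x :
  regmx F -> regmx G ->
  Dmx v (fun y => F y *m G y) x = Dmx v F x *m G x + F x *m Dmx v G x.
Proof.
move=> rF rG; apply/matrixP => i j; rewrite !mxE.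
rewrite (_ : (fun _ => _) = fun x => \sum_k F x i k * G x k j); last first.
  by apply/funext => y; rewrite mxE.
rewrite der_sum => [|k]; last exact: regular_mul.
by rewrite -big_split; apply: eq_bigr => k _; rewrite der_mul // !mxE.
Qed.

Lemma Dmx_scale p q (f : GLpt C r -> C) (F : GLpt C r -> 'M[C]_(p, q)) x :
  regular f -> regmx F ->
  Dmx v (fun y => f y *: F y) x = v f x *: F x + f x *: Dmx v F x.
Proof.
move=> rf rF; apply/matrixP => i j; rewrite !mxE -der_mul //.
by congr (v _ _); apply/funext => y; rewrite mxE.
Qed.

Lemma Dmx_const p q (A : 'M[C]_(p, q)) x : Dmx v (fun=> A) x = 0.
Proof. by apply/matrixP => i j; rewrite !mxE der_const. Qed.

Lemma regmx_Dmx p q (F : GLpt C r -> 'M[C]_(p, q)) : regmx F -> regmx (Dmx v F).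
Proof.
move=> rF i j; rewrite (_ : (fun _ => _) = v (fun y => F y i j)).
  exact: der_regular.
by apply/funext => x; rewrite mxE.
Qed.

End Derivations.

Lemma derivation_bracket r (u v : vfield C r) :
  derivation u -> derivation v -> derivation (vbracket u v).
Proof.
move=> du dv; split.
- move=> f rf; rewrite /vbracket.
  rewrite (_ : (fun _ => _) = fun x => u (v f) x + (-1) * v (u f) x); last first.
    by apply/funext => x; rewrite mulN1r.
  apply: regular_add; first by do 2! apply: der_regular => //.
  by apply: regular_mul; [exact: regular_const|do 2! apply: der_regular => //].
- move=> f g rf rg; apply/funext => x; rewrite /vbracket.
  case: (du) => _ uD _ _; case: (dv) => _ vD _ _.
  rewrite uD // vD // uD ?vD; try by apply: der_regular.
  by ring.
- move=> c f rf; apply/funext => x; rewrite /vbracket.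
  case: (du) => _ _ uZ _; case: (dv) => _ _ vZ _.
  rewrite uZ // vZ // uZ ?vZ; try by apply: der_regular.
  by ring.
- move=> f g rf rg; apply/funext => x; rewrite /vbracket.
  case: (du) => ur uD _ uM; case: (dv) => vr vD _ vM.
  rewrite uM // vM // (uD (fun x => v f x * g x)) ?(vD (fun x => u f x * g x));
    try by (apply: regular_mul; auto).
  rewrite !uM ?vM; auto.
  by ring.
Qed.

End RegularFunctions.

(** * Directional derivatives of regular functions, and vector fields made from them *)

Section LineDerivatives.
Variable C : numFieldType.

Lemma poly_eval0 (p : {poly C}) : (forall t, p.[t] = 0) -> p = 0.
Proof.
move=> p0; apply/eqP/negPn/negP => pn0.
pose s : seq C := [seq k%:R | k <- iota 0 (size p)].
have : (size s < size p)%N.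
  apply: max_poly_roots => //; first by apply/allP => a _; apply/eqP.
  by rewrite map_inj_uniq ?iota_uniq // => i j /eqP; rewrite eqr_nat => /eqP.
by rewrite size_map size_iota ltnn.
Qed.

Lemma poly_eval_inj (p q : {poly C}) : (forall t, p.[t] = q.[t]) -> p = q.
Proof.
by move=> pq; apply/eqP; rewrite -subr_eq0; apply/eqP/poly_eval0 => t;
  rewrite hornerD hornerN pq subrr.
Qed.

Lemma det_line r (A E : 'M[C]_r) :
  exists d : {poly C}, forall t, d.[t] = \det (A + t *: E).
Proof.
exists (\det (map_mx polyC A + 'X *: map_mx polyC E)) => t.
rewrite -horner_evalE -det_map_mx; congr (\det _).
by apply/matrixP => i j; rewrite !mxE /= horner_evalE !hornerE.
Qed.

Section OneGroup.
Variable r : nat.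
Implicit Types (f g : GLpt C r -> C) (x : GLpt C r) (E : 'M[C]_r).

(** The line meets GL_r where det(x + tE) is nonzero, and this polynomial in t does not vanish at 0.
    Multiplying p - q by it gives a polynomial that is zero everywhere. *)
Lemma poly_line_eq (p q : {poly C}) x E :
  (forall t (y : GLpt C r), val y = val x + t *: E -> p.[t] = q.[t]) -> p = q.
Proof.
move=> pq; have [d dE] := det_line (val x) E.
have d0 : d != 0.
  apply/eqP => d0; have := det_neq0 x.
  by rewrite -[val x]addr0 -(scale0r E) -dE d0 horner0 eqxx.
apply/eqP; rewrite -subr_eq0; have : (p - q) * d == 0.
  apply/eqP/poly_eval0 => t; rewrite hornerM dE.
  have [->|dt] := eqVneq (\det (val x + t *: E)) 0; first by rewrite mulr0.
  have tu : val x + t *: E \in unitmx by rewrite unitmxE unitfE.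
  by rewrite hornerD hornerN (pq t (exist (fun A : 'M[C]_r => A \in unitmx) _ tu)) // subrr mul0r.
by rewrite mulf_eq0 (negPf d0) orbF.
Qed.

(** Along the line x + tE a regular function is a quotient p(t)/q(t); the
    derivative c at t = 0 is read off from c q(0) = p'(0) - f(x) q'(0). *)
Definition line_diff E f x (c : C) : Prop :=
  exists p q : {poly C}, [/\ q.[0] != 0,
    forall t y, val y = val x + t *: E -> f y * q.[t] = p.[t]
  & c * q.[0] = p^`().[0] - f x * q^`().[0]].

Lemma line_diff0 f x E (p q : {poly C}) :
  (forall t y, val y = val x + t *: E -> f y * q.[t] = p.[t]) -> p.[0] = f x * q.[0].
Proof. by move=> h; rewrite -(h 0 x) // scale0r addr0. Qed.

Lemma line_diff_uniq E f x c c' : line_diff E f x c -> line_diff E f x c' -> c = c'.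
Proof.
move=> [p [q [q0 pq ec]]] [p' [q' [q'0 pq' ec']]].
(* Both quotients represent f on the invertible points of the line, so they agree as fractions and
   may be differentiated at 0. *)
have e : p * q' = p' * q.
  by apply: (@poly_line_eq _ _ x E) => t y ty; rewrite !hornerM -(pq t y) // -(pq' t y) //; ring.
have := congr1 (fun s : {poly C} => s^`().[0]) e.
rewrite !derivM !hornerD !hornerM (line_diff0 pq) (line_diff0 pq') => e2.
apply: (mulIf q0); apply: (mulIf q'0).
rewrite ec [RHS]mulrAC ec'; move: e2.
move: p^`().[0] q^`().[0] p'^`().[0] q'^`().[0] q.[0] q'.[0] (f x) => a b a' b' u u' w e2.
have -> : (a - w * b) * u' = (a * u' + w * u * b') - w * u * b' - w * b * u' by ring.
by rewrite e2; ring.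
Qed.

Lemma line_diff_const E c x : line_diff E (fun=> c) x 0.
Proof.
exists c%:P, 1; split=> [|t y _|]; rewrite !hornerE ?oner_eq0 //.
by rewrite !derivE !hornerE oppr0.
Qed.

Lemma line_diff_coord E i j x : line_diff E (fun y => val y i j) x (E i j).
Proof.
exists ((val x i j)%:P + E i j *: 'X), 1; split=> [|t y ->|].
- by rewrite !hornerE oner_eq0.
- by rewrite !hornerE !mxE mulrC.
by rewrite !derivE !hornerE /= subr0.
Qed.

Lemma line_diff_add E f g x c c' : line_diff E f x c -> line_diff E g x c' ->
  line_diff E (fun y => f y + g y) x (c + c').
Proof.
move=> [p [q [q0 pq ec]]] [p' [q' [q'0 pq' ec']]].
exists (p * q' + p' * q), (q * q'); split.
- by rewrite hornerM mulf_neq0.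
- by move=> t y ty; rewrite hornerD !hornerM -(pq t y) // -(pq' t y) //; ring.
rewrite !derivE !hornerD !hornerM.
rewrite (line_diff0 pq) (line_diff0 pq').
have -> : (c + c') * (q.[0] * q'.[0]) = c * q.[0] * q'.[0] + c' * q'.[0] * q.[0] by ring.
by rewrite ec ec'; ring.
Qed.

Lemma line_diff_mul E f g x c c' : line_diff E f x c -> line_diff E g x c' ->
  line_diff E (fun y => f y * g y) x (c * g x + f x * c').
Proof.
move=> [p [q [q0 pq ec]]] [p' [q' [q'0 pq' ec']]].
exists (p * p'), (q * q'); split.
- by rewrite hornerM mulf_neq0.
- by move=> t y ty; rewrite !hornerM -(pq t y) // -(pq' t y) //; ring.
rewrite !derivE !hornerD !hornerM.
rewrite (line_diff0 pq) (line_diff0 pq').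
have -> : (c * g x + f x * c') * (q.[0] * q'.[0])
  = c * q.[0] * q'.[0] * g x + c' * q'.[0] * q.[0] * f x by ring.
by rewrite ec ec'; ring.
Qed.

(** An upper bound on the degree, attached to a way of writing the function: polynomial functions
    are given by values, with no formal polynomial to measure. *)
Inductive polydeg : nat -> ('M[C]_r -> C) -> Prop :=
| pd_const d c : polydeg d (fun=> c)
| pd_coord d i j : polydeg d.+1 (fun A => A i j)
| pd_add d (f g : 'M[C]_r -> C) : polydeg d f -> polydeg d g -> polydeg d (fun A => f A + g A)
| pd_mul d e (f g : 'M[C]_r -> C) :
    polydeg d f -> polydeg e g -> polydeg (d + e) (fun A => f A * g A).

Lemma polydeg_leq d e (f : 'M[C]_r -> C) : polydeg d f -> (d <= e)%N -> polydeg e f.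
Proof.
move=> pf; elim: pf e => {d f} [d c|d i j|d f g _ If _ Ig|d d' f g _ If _ Ig] e.
- by move=> _; exact: pd_const.
- by case: e => // e _; exact: pd_coord.
- by move=> de; apply: pd_add; [exact: If|exact: Ig].
move=> de; rewrite -(subnKC (leq_trans (leq_addr d' d) de)).
by apply: pd_mul; [exact: If|apply: Ig; rewrite leq_subRL ?(leq_trans (leq_addr _ _) de)].
Qed.

Lemma polyfun_polydeg P : is_polyfun P -> exists d, polydeg d P.
Proof.
elim=> {P} [c|i j|f g _ [d pf] _ [e pg]|f g _ [d pf] _ [e pg]].
- by exists 0; exact: pd_const.
- by exists 1; exact: pd_coord.
- exists (maxn d e); apply: pd_add.
    exact: polydeg_leq pf (leq_maxl _ _).
  exact: polydeg_leq pg (leq_maxr _ _).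
by exists (d + e)%N; exact: pd_mul.
Qed.

Lemma polydeg_polyfun d P : polydeg d P -> is_polyfun P.
Proof.
elim=> *; [exact: pf_const|exact: pf_coord|exact: pf_add|exact: pf_mul].
Qed.

(** [P' A E] is the derivative of P at A in direction E. Its polynomial dependence on A for a moving
    direction makes line fields preserve regularity; the degree drop for a fixed direction drives
    the descent in differential ideals. Degree 0 has its own clause because [d.-1] does not decrease
    there. *)
Lemma polydeg_line d P : polydeg d P ->
  exists P' : 'M[C]_r -> 'M[C]_r -> C,
    (forall A E, exists p : {poly C},
       (forall t, p.[t] = P (A + t *: E)) /\ p^`().[0] = P' A E)
    /\ (forall xi : 'M[C]_r -> 'M[C]_r, (forall i j, is_polyfun (fun A => xi A i j)) ->
         is_polyfun (fun A => P' A (xi A)))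
    /\ (forall E, polydeg d.-1 (P' ^~ E) /\ (d = 0%N -> P' ^~ E = fun=> 0)).
Proof.
elim=> {d P} [d c|d i j|d f g pf [f' [fl [fxi fx]]] pg [g' [gl [gxi gx]]]|
  d e f g pf [f' [fl [fxi fx]]] pg [g' [gl [gxi gx]]]].
- exists (fun _ _ => 0); split=> [A E|]; last first.
    by split=> [xi _|E]; [exact: pf_const|split=> //; exact: pd_const].
  by exists c%:P; rewrite derivC horner0; split=> // t; rewrite hornerC.
- exists (fun _ E => E i j); split=> [A E|]; last first.
    by split=> [xi|E]; [exact|split=> //; exact: pd_const].
  exists ((A i j)%:P + E i j *: 'X); split=> [t|]; first by rewrite !hornerE !mxE mulrC.
  by rewrite !derivE !hornerE.
- exists (fun A E => f' A E + g' A E); split=> [A E|]; last split=> [xi hxi|E].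
  - have [p [ep dp]] := fl A E; have [q [eq dq]] := gl A E.
    exists (p + q); split=> [t|]; first by rewrite hornerD ep eq.
    by rewrite derivD hornerD dp dq.
  - by apply: pf_add; [exact: fxi|exact: gxi].
  - have [a b] := fx E; have [a' b'] := gx E; split; first exact: pd_add a a'.
    move=> d0; apply/funext => A; have := b d0; have := b' d0.
    by move=> /(congr1 (@^~ A)) -> /(congr1 (@^~ A)) ->; rewrite addr0.
exists (fun A E => f' A E * g A + f A * g' A E); split=> [A E|]; last split=> [xi hxi|E].
- have [p [ep dp]] := fl A E; have [q [eq dq]] := gl A E.
  exists (p * q); split=> [t|]; first by rewrite hornerM ep eq.
  by rewrite derivM hornerD !hornerM dp dq ep eq scale0r addr0.
- by apply: pf_add; apply: pf_mul; [exact: fxi|exact: polydeg_polyfun pg|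
    exact: polydeg_polyfun pf|exact: gxi].
  have [a b] := fx E; have [a' b'] := gx E; split; last first.
    move=> /eqP; rewrite addn_eq0 => /andP[/eqP d0 /eqP e0].
    apply/funext => A; have := b d0; have := b' e0.
    by move=> /(congr1 (@^~ A)) -> /(congr1 (@^~ A)) ->; rewrite mul0r mulr0 addr0.
  apply: pd_add.
    case: d {pf fx} a b => [_ /(_ erefl) b|d a _]; last exact: (pd_mul a pg).
    rewrite (_ : (fun _ => _) = fun=> 0); first exact: pd_const.
    by apply/funext => A; move: b => /(congr1 (@^~ A)) ->; rewrite mul0r.
  case: e {pg gx} a' b' => [_ /(_ erefl) b'|e a' _].
    rewrite (_ : (fun _ => _) = fun=> 0); first exact: pd_const.
    by apply/funext => A; move: b' => /(congr1 (@^~ A)) ->; rewrite mulr0.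
  by rewrite addnS; exact: (pd_mul pf a').
Qed.

Lemma regular_line_diff f : regular f -> exists f' : 'M[C]_r -> GLpt C r -> C,
  (forall E x, line_diff E f x (f' E x)) /\
  (forall xi : 'M[C]_r -> 'M[C]_r, (forall i j, is_polyfun (fun A => xi A i j)) ->
     regular (fun x => f' (xi (val x)) x)).
Proof.
move=> [P [k [pP eP]]].
have [e dP] := polyfun_polydeg pP.
have [l dQ] := polyfun_polydeg (polyfun_exp k (polyfun_det C r)).
have [P' [lP [rP' _]]] := polydeg_line dP; have [Q' [lQ [rQ' _]]] := polydeg_line dQ.
(* The quotient rule for P / det^k, with P / det^k written again as f. *)
exists (fun E x => (P' (val x) E - f x * Q' (val x) E) * (\det (val x))^-1 ^+ k).
split=> [E x|xi hxi].
  have [p [ep dp]] := lP (val x) E; have [q [eq dq]] := lQ (val x) E.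
  have q0 : q.[0] = \det (val x) ^+ k by rewrite eq scale0r addr0.
  have n0 : \det (val x) ^+ k != 0 by rewrite expf_neq0 // det_neq0.
  exists p, q; split; first by rewrite q0.
    move=> t y ty; rewrite ep eq -ty eP divfK // expf_neq0 //; exact: det_neq0.
  by rewrite q0 dp dq exprVn divfK.
apply: regular_mul; last exact: regular_exp (regular_detV C r).
rewrite (_ : (fun _ => _) = fun x : GLpt C r =>
   P' (val x) (xi (val x)) + (-1) * (f x * Q' (val x) (xi (val x)))); last first.
  by apply/funext => x; rewrite mulN1r.
apply: regular_add; first exact: (polyfun_regular (rP' xi hxi)).
apply: regular_mul; first exact: regular_const.
apply: regular_mul; first by exists P, k.
exact: (polyfun_regular (rQ' xi hxi)).
Qed.

(** The field with value [xi (val x)] at x. A [vfield] must act on every function, so 0 is returned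
    where no line derivative exists. *)
Definition line_field (xi : 'M[C]_r -> 'M[C]_r) : vfield C r :=
  fun f x => xget 0 [set c | line_diff (xi (val x)) f x c]%classic.

Implicit Types xi : 'M[C]_r -> 'M[C]_r.

Lemma line_fieldE xi f x c : line_diff (xi (val x)) f x c -> line_field xi f x = c.
Proof.
move=> h; rewrite /line_field; case: xgetP => [c' _ /= h'|/(_ c)//].
exact: line_diff_uniq h' h.
Qed.

Lemma line_fieldP xi f x : regular f -> line_diff (xi (val x)) f x (line_field xi f x).
Proof.
by move=> /regular_line_diff [f' [h _]]; rewrite (line_fieldE (h _ x)).
Qed.

Lemma line_field_coord xi i j x : line_field xi (fun y => val y i j) x = xi (val x) i j.
Proof. by apply: line_fieldE; exact: line_diff_coord. Qed.

Lemma line_field_derivation xi : (forall i j, is_polyfun (fun A => xi A i j)) ->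
  derivation (line_field xi).
Proof.
move=> hxi; split.
- move=> f /regular_line_diff [f' [h h2]].
  rewrite (_ : line_field xi f = fun x => f' (xi (val x)) x); first exact: h2.
  by apply/funext => x; apply: line_fieldE.
- move=> f g rf rg; apply/funext => x; apply: line_fieldE.
  by apply: line_diff_add; apply: line_fieldP.
- move=> c f rf; apply/funext => x; apply: line_fieldE.
  rewrite (_ : c * _ = 0 * f x + c * line_field xi f x); last by rewrite mul0r add0r.
  by apply: line_diff_mul (line_diff_const _ _ _) (line_fieldP _ _ rf).
move=> f g rf rg; apply/funext => x; apply: line_fieldE.
by apply: line_diff_mul; apply: line_fieldP.
Qed.

End OneGroup.

Section ChainRule.
Variables (p q : nat) (phi : GLpt C p -> GLpt C q) (v : vfield C p).
Hypothesis rphi : regmx (fun x => val (phi x)).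
Hypothesis rdetV : regular (fun x => (\det (val (phi x)))^-1).

Lemma polyfun_comp_regular (P : 'M[C]_q -> C) :
  is_polyfun P -> regular (fun x => P (val (phi x))).
Proof.
elim=> {P} [c|i j|f g _ rf _ rg|f g _ rf _ rg].
- exact: regular_const.
- exact: rphi.
- exact: regular_add.
exact: regular_mul.
Qed.

Lemma regular_comp (f : GLpt C q -> C) : regular f -> regular (fun x => f (phi x)).
Proof.
move=> [P [k [pP eP]]].
rewrite (_ : (fun _ => _) = fun x => P (val (phi x)) * (\det (val (phi x)))^-1 ^+ k).
  by apply: regular_mul; [exact: polyfun_comp_regular|exact: regular_exp].
by apply/funext => x; rewrite eP exprVn.
Qed.

Lemma polyfun_chain (dv : derivation v) (P : 'M[C]_q -> C) x : is_polyfun P ->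
  exists s : {poly C},
    (forall t, s.[t] = P (val (phi x) + t *: Dmx v (fun y => val (phi y)) x))
    /\ s^`().[0] = v (fun y => P (val (phi y))) x.
Proof.
set E := Dmx _ _ x.
elim=> {P} [c|i j|f g pf [a [ea da]] pg [b [eb db]]|f g pf [a [ea da]] pg [b [eb db]]].
- by exists c%:P; rewrite derivC horner0 (der_const dv); split=> // t; rewrite hornerC.
- exists ((val (phi x) i j)%:P + E i j *: 'X); split=> [t|].
    by rewrite !hornerE !mxE mulrC.
  by rewrite !derivE !hornerE mxE.
- exists (a + b); split=> [t|]; first by rewrite hornerD ea eb.
  by rewrite derivD hornerD da db (der_add dv) //; apply: polyfun_comp_regular.
exists (a * b); split=> [t|]; first by rewrite hornerM ea eb.
rewrite derivM hornerD !hornerM da db ea eb scale0r addr0.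
by rewrite (der_mul dv) //; apply: polyfun_comp_regular.
Qed.

(** Applying the product rule to P = f det^k, composed with phi, yields precisely the relation that
    [line_diff] demands. *)
Lemma chain_rule (dv : derivation v) (f : GLpt C q -> C) x : regular f ->
  line_diff (Dmx v (fun y => val (phi y)) x) f (phi x) (v (fun y => f (phi y)) x).
Proof.
move=> rf; have [P [k [pP eP]]] := rf.
have pQ := polyfun_exp k (polyfun_det C q).
have [s [es ds]] := polyfun_chain dv x pP.
have [d [ed dd]] := polyfun_chain dv x pQ.
have d0 : d.[0] = \det (val (phi x)) ^+ k by rewrite ed scale0r addr0.
exists s, d; split.
- by rewrite d0 expf_neq0 // det_neq0.
- by move=> t y ty; rewrite es ed -ty eP divfK // expf_neq0 // det_neq0.
rewrite d0 ds dd.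
rewrite (_ : (fun y => P _) = fun y => f (phi y) * \det (val (phi y)) ^+ k); last first.
  by apply/funext => y; rewrite eP divfK // expf_neq0 // det_neq0.
rewrite (der_mul dv) ?addrK //; first exact: regular_comp.
exact: polyfun_comp_regular pQ.
Qed.

End ChainRule.

End LineDerivatives.

(** * Ideals of regular functions stable under partial derivatives *)

Section DifferentialIdeals.
Variables (C : numFieldType) (r : nat).

Lemma deriv_eq0_const (p : {poly C}) t : p^`() = 0 -> p.[t] = p.[0].
Proof.
move=> dp; have -> : p = (p`_0)%:P; last by rewrite !hornerC.
apply/polyP => -[|i]; rewrite coefC //=.
have := coef_deriv p i; rewrite dp coef0 => /esym/eqP.
by rewrite mulrn_eq0 => /eqP.
Qed.

Lemma polydeg_zero_GL d (P : 'M[C]_r -> C) : polydeg d P ->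
  (forall x : GLpt C r, P (val x) = 0) -> forall A, P A = 0.
Proof.
move=> /polydeg_line[P' [lP _]] P0 A.
pose one : GLpt C r := exist (fun A : 'M[C]_r => A \in unitmx) _ (unitmx1 C r).
(* The line from the identity to A starts in GL_r, so vanishing on invertible matrices forces
   vanishing along all of it. *)
have [p [ep _]] := lP 1%:M (A - 1%:M).
have -> : P A = p.[1] by rewrite ep scale1r addrC subrK.
rewrite (_ : p = 0) ?horner0 //.
apply: (@poly_line_eq C r _ _ one (A - 1%:M)) => t y ty.
by rewrite ep -[1%:M]/(val one) -ty P0 horner0.
Qed.

Lemma polydeg_const_of_partials d (P : 'M[C]_r -> C) (P' : 'M[C]_r -> 'M[C]_r -> C) :
  polydeg d P ->
  (forall A E, exists p : {poly C},
     (forall t, p.[t] = P (A + t *: E)) /\ p^`().[0] = P' A E) ->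
  (forall A i j, P' A (delta_mx i j) = 0) -> forall A, P A = P 0.
Proof.
move=> dP lP P'0 A.
have step i j t B : P (B + t *: delta_mx i j) = P B.
  have [p [ep _]] := lP B (delta_mx i j).
  rewrite -ep -[in RHS](addr0 B) -(scale0r (delta_mx i j)) -ep.
  apply/deriv_eq0_const/poly_eval0 => u.
  have [q [eq dq]] := lP (B + u *: delta_mx i j) (delta_mx i j).
  (* Moving the base point by u translates the parameter, so the partial derivative at the new base
     point is the derivative of p at u. *)
  have qp : q = p \Po ('X + u%:P).
    apply: poly_eval_inj => s; rewrite eq horner_comp !hornerE ep.
    by rewrite -addrA -scalerDl addrC [u + s]addrC addrC.
  move: dq; rewrite P'0 qp deriv_comp derivD derivX derivC addr0 mulr1.
  by rewrite horner_comp !hornerE.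
suff H X : forall B, P (B + X) = P B by rewrite -[A]add0r H.
rewrite [X]matrix_sum_delta; apply: (big_ind (fun X => forall B, P (B + X) = P B)).
- by move=> B; rewrite addr0.
- by move=> Y Z hY hZ B; rewrite addrA hZ hY.
move=> i _; apply: (big_ind (fun X => forall B, P (B + X) = P B)).
- by move=> B; rewrite addr0.
- by move=> Y Z hY hZ B; rewrite addrA hZ hY.
by move=> j _ B; apply: step.
Qed.

(** Differentiating lowers the degree of a polynomial element of the ideal
    until a nonzero constant is reached. *)
Lemma differential_ideal_1 (I : (GLpt C r -> C) -> Prop) :
  (forall a h, regular a -> I h -> I (fun x => a x * h x)) ->
  (forall i j h, regular h -> I h -> I (line_field (fun=> delta_mx i j) h)) ->
  forall h x, regular h -> I h -> h x != 0 -> I (fun=> 1).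
Proof.
move=> IM ID h x0 [P [k [pP eP]]] Ih hx0.
have IP : I (fun x => P (val x)).
  rewrite (_ : (fun _ => _) = fun x => \det (val x) ^+ k * h x).
    apply: IM => //; apply: regular_exp; exact: regular_det.
  by apply/funext => x; rewrite eP mulrC divfK // expf_neq0 // det_neq0.
have Px0 : P (val x0) != 0.
  by move: hx0; rewrite eP; apply: contraNneq => ->; rewrite mul0r.
have [d] := polyfun_polydeg pP; have [m] := ubnP d.
elim: m d P x0 {hx0 pP eP} Px0 IP => // m IH d P x0 Px0 IP; rewrite ltnS => dm dP.
have [P' [lP [rP' dP']]] := polydeg_line dP.
have [[i [j [y Py]]]|none] :=
  pselect (exists i j (y : GLpt C r), P' (val y) (delta_mx i j) != 0); last first.
  have const A : P A = P 0.
    apply: polydeg_const_of_partials dP lP _ A => B i j.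
    have [dE _] := dP' (delta_mx i j).
    apply: (polydeg_zero_GL dE) => y.
    by apply/eqP/negP => /negP Py; apply: none; exists i, j, y.
  rewrite (_ : (fun=> 1) = fun x => (P 0)^-1 * P (val x)).
    by apply: IM => //; exact: regular_const.
  by apply/funext => x; rewrite const mulVf // -(const (val x0)).
have [dE d0] := dP' (delta_mx i j).
have d_gt0 : (0 < d)%N.
  by rewrite lt0n; apply/eqP => /d0 e; move: Py; rewrite -[P' _ _]/((P' ^~ _) _) e eqxx.
apply: (IH d.-1 (P' ^~ (delta_mx i j)) y Py) => //; last by rewrite prednK.
rewrite (_ : (fun _ => _) =
   line_field (fun=> delta_mx i j) (fun x : GLpt C r => P (val x))).
  by apply: ID => //; exact: polyfun_regular (polydeg_polyfun dP).
apply/funext => x; apply/esym/line_fieldE.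
have [p [ep dp]] := lP (val x) (delta_mx i j).
exists p, 1; split=> [|t z tz|]; first by rewrite hornerE oner_eq0.
  by rewrite hornerE mulr1 ep tz.
by rewrite !derivE !hornerE dp oppr0 addr0.
Qed.

End DifferentialIdeals.

(** * D-module isomorphisms as gauge transformations *)

Section Isomorphisms.
Variables (C : fieldType) (r n : nat).
Implicit Types al be : pairing C r n.

(** The equation dF + be F = F al says that multiplication by F is horizontal from M_al to M_be. The
    inverse is an explicit argument because it has to be regular too. *)
Definition gauge_equiv al be (F F' : GLpt C r -> 'M[C]_n) : Prop :=
  [/\ regmx F, regmx F', forall x, F x *m F' x = 1%:M
    & forall v, derivation v -> forall x,
        Dmx v F x + be v x *m F x = F x *m al v x].

Lemma gauge_equiv_sym al be F F' : gauge_equiv al be F F' -> gauge_equiv be al F' F.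
Proof.
move=> [rF rF' FF' e]; have F'F x := mulmx1C (FF' x).
split=> // v dv x; have := Dmx_mul dv x rF rF'.
rewrite (_ : (fun y => _) = fun=> 1%:M); last by apply/funext.
rewrite (Dmx_const dv) => /esym/eqP; rewrite addr_eq0 => /eqP e2.
have e3 : Dmx v F x = F x *m al v x - be v x *m F x by rewrite -(e v dv) addrK.
have -> : Dmx v F' x = - (F' x *m (Dmx v F x *m F' x)).
  by rewrite e2 mulmxN opprK mulmxA F'F mul1mx.
rewrite e3 mulmxBl mulmxBr !mulmxA F'F mul1mx -!mulmxA FF' mulmx1.
by rewrite opprB subrK.
Qed.

Lemma gauge_equiv_hom al be F F' : gauge_equiv al be F F' ->
  Dmod_hom al be (fun f x => F x *m f x).
Proof.
move=> [rF rF' FF' e]; split.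
- by move=> f rf; apply: regmx_mul.
- by move=> f g _ _; apply/funext => x; rewrite mulmxDr.
- by move=> c f _ _; apply/funext => x; rewrite scalemxAr.
move=> v f dv rf; apply/funext => x; rewrite /dact (Dmx_mul dv) // mulmxDr mulmxA -e //.
by rewrite mulmxDl addrCA addrA mulmxA [_ + F x *m _]addrC.
Qed.

(** C[G]-linearity on a free module: the columns of F are the images of the constant basis. [phi] is
    constrained only on regular sections, so the formula is claimed only there. *)
Lemma Dmod_hom_mx al be phi : Dmod_hom al be phi ->
  exists F, regmx F /\ forall f x, regmx f -> phi f x = F x *m f x.
Proof.
case=> [pr pD pZ _].
pose e (j : 'I_n) (_ : GLpt C r) : 'cV[C]_n := delta_mx j 0.
have re j : regmx (e j) by exact: regmx_const.
have phi0 : phi (fun=> 0) = fun=> 0.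
  have := pZ (fun=> 0) (fun=> 0) (regular_const r 0) (regmx_const r 0).
  rewrite (_ : (fun x => _) = fun=> 0) => [->|]; last by apply/funext => x; rewrite scale0r.
  by apply/funext => x; rewrite scale0r.
exists (fun x => \matrix_(i, j) phi (e j) x i 0); split.
  move=> i j; rewrite (_ : (fun _ => _) = fun x => phi (e j) x i 0).
    exact: pr.
  by apply/funext => x; rewrite mxE.
move=> f x rf.
have sum (s : seq 'I_n) : phi (fun y => \sum_(j <- s) f y j 0 *: e j y)
     = (fun y => \sum_(j <- s) f y j 0 *: phi (e j) y)
   /\ regmx (fun y => \sum_(j <- s) f y j 0 *: e j y).
  elim: s => [|j s [IH1 IH2]].
    rewrite (_ : (fun y => _) = fun=> 0); last by apply/funext => y; rewrite big_nil.
    rewrite phi0; split; last exact: regmx_const.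
    by apply/funext => y; rewrite big_nil.
  have E (g : 'I_n -> GLpt C r -> 'cV[C]_n) :
      (fun y => \sum_(i <- j :: s) f y i 0 *: g i y)
      = fun y => f y j 0 *: g j y + \sum_(i <- s) f y i 0 *: g i y.
    by apply/funext => y; rewrite big_cons.
  have rj : regmx (fun y => f y j 0 *: e j y) by apply: regmx_scale.
  by rewrite !E pD // IH1 pZ //; split=> //; apply: regmx_add.
have [sE _] := sum (index_enum 'I_n).
have -> : f = fun y => \sum_j f y j 0 *: e j y.
  apply/funext => y; rewrite [LHS]matrix_sum_delta; apply: eq_bigr => j _.
  by rewrite big_ord1.
rewrite sE; apply/matrixP => i k; rewrite ord1 summxE mxE; apply: eq_bigr => j _.
rewrite !mxE mulrC; congr (_ * _).
rewrite summxE (bigD1 j) //= !mxE !eqxx mulr1 big1 ?addr0 // => l lj.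
by rewrite !mxE [j == l]eq_sym (negPf lj) mulr0.
Qed.

Lemma Dmod_isoP al be :
  (forall v, derivation v -> regmx (al v)) -> 
  Dmod_iso al be <-> exists F F', gauge_equiv al be F F'.
Proof.
move=> ral; split; last first.
  move=> [F [F' g]]; exists (fun f x => F x *m f x), (fun f x => F' x *m f x).
  have g' := gauge_equiv_sym g; split.
  - exact: gauge_equiv_hom g.
  - exact: gauge_equiv_hom g'.
  - by case: g' => _ _ F'F _ f _; apply/funext => x; rewrite mulmxA F'F mul1mx.
  - by case: g => _ _ FF' _ f _; apply/funext => x; rewrite mulmxA FF' mul1mx.
move=> [phi [psi [hphi hpsi pk _]]].
have [F [rF eF]] := Dmod_hom_mx hphi; have [F' [rF' eF']] := Dmod_hom_mx hpsi.
have colext (A B : 'M[C]_n) : (forall j, A *m delta_mx j (0 : 'I_1) = B *m delta_mx j 0) -> A = B.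
  move=> h; apply/matrixP => i j; have /matrixP/(_ i 0) := h j.
  by rewrite -!colE !mxE.
have [pr _ _ pv] := hphi.
have re j : regmx (fun _ : GLpt C r => delta_mx j 0 : 'cV[C]_n) by exact: regmx_const.
exists F, F'; split=> // [x|v dv x].
  apply: mulmx1C; apply: colext => j; rewrite mul1mx -mulmxA.
  have := pk _ (re j) => /(congr1 (@^~ x)) {2}<-.
  by rewrite eF' ?eF //; exact: pr.
apply: colext => j; have := pv v _ dv (re j) => /(congr1 (@^~ x)).
have -> : dact al v (fun=> delta_mx j 0) = fun y => al v y *m delta_mx j 0.
  by apply/funext => y; rewrite /dact (Dmx_const dv) add0r.
(* The section [al v e_j] must be regular before the matrix formula for [phi] applies; this is where
   regularity of [al] enters. *)
rewrite eF; last by apply: regmx_mul => //; exact: ral.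
rewrite -mulmxA => ->; rewrite /dact mulmxDl -mulmxA.
rewrite (_ : phi _ = fun y => F y *m delta_mx j 0); last first.
  by apply/funext => y; rewrite eF.
by rewrite (Dmx_mul dv) // (Dmx_const dv) mulmx0 addr0.
Qed.

End Isomorphisms.

(** * The coordinate ring of GL_r as an integral domain *)

Section CoordinateRing.
Variables (C : numFieldType) (r : nat).

Definition regular_pred : {pred GLpt C r -> C} := fun f => `[< regular f >].

Lemma regular_predP f : reflect (regular f) (f \in regular_pred).
Proof. exact: asboolP. Qed.

Lemma regular_subring_closed : subring_closed regular_pred.
Proof.
split.
- by apply/regular_predP; exact: (regular_const r 1).
- move=> f g /regular_predP rf /regular_predP rg; apply/regular_predP.
  rewrite (_ : f - g = fun x => f x + (-1) * g x).
    by apply: regular_add => //; apply: regular_mul => //; exact: regular_const.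
  by apply/funext => x; rewrite mulN1r.
move=> f g /regular_predP rf /regular_predP rg; apply/regular_predP.
exact: regular_mul.
Qed.

HB.instance Definition _ :=
  GRing.isSubringClosed.Build _ regular_pred regular_subring_closed.

(** Bundling regular functions into a ring makes the fraction field, hence the generic matrix,
    available. *)
Record coord_ring := CoordRing {
  coord_fun :> GLpt C r -> C;
  coord_funP : coord_fun \in regular_pred }.

HB.instance Definition _ := [isSub for coord_fun].
HB.instance Definition _ := [Choice of coord_ring by <:].
HB.instance Definition _ :=
  GRing.SubChoice_isSubComPzRing.Build _ _ coord_ring (GRing.subringClosedP _).

Lemma coordP (f g : coord_ring) : (forall x, f x = g x) -> f = g.
Proof. by move=> fg; apply/val_inj/funext. Qed.

Lemma coord_regular (f : coord_ring) : regular f.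
Proof. exact/regular_predP/coord_funP. Qed.

Definition mk_coord f (rf : regular f) : coord_ring :=
  CoordRing (introT (regular_predP f) rf).

Lemma coordME (f g : coord_ring) x : (f * g) x = f x * g x. Proof. by []. Qed.

Definition GL1pt : GLpt C r := exist (fun A : 'M[C]_r => A \in unitmx) _ (unitmx1 C r).

Lemma coord_ring_oner_neq0 : 1 != 0 :> coord_ring.
Proof.
by apply/eqP => /(congr1 (fun f : coord_ring => f GL1pt)) /eqP; rewrite oner_eq0.
Qed.
HB.instance Definition _ :=
  GRing.PzSemiRing_isNonZero.Build coord_ring coord_ring_oner_neq0.

Definition coord_unit (f : coord_ring) : bool := `[< exists g, g * f = 1 >].
Definition coord_inv (f : coord_ring) : coord_ring :=
  if pselect (exists g, g * f = 1) is left h then projT1 (cid h) else f.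

Lemma coord_mulVf f : coord_unit f -> coord_inv f * f = 1.
Proof.
by move=> /asboolP h; rewrite /coord_inv; case: pselect => // h'; case: (cid h').
Qed.
Lemma coord_unitP f g : g * f = 1 -> coord_unit f.
Proof. by move=> h; apply/asboolP; exists g. Qed.
Lemma coord_inv_out f : ~~ coord_unit f -> coord_inv f = f.
Proof. by move=> /asboolP h; rewrite /coord_inv; case: pselect. Qed.

HB.instance Definition _ :=
  GRing.ComNzRing_hasMulInverse.Build coord_ring coord_mulVf coord_unitP coord_inv_out.

(** On the line joining a point with f <> 0 to one with g <> 0, both are
    nonzero quotients of one-variable polynomials. *)
Lemma coord_integral (f g : coord_ring) : f * g = 0 -> (f == 0) || (g == 0).
Proof.
move=> fg; apply/orP; case: (pselect (f = 0)) => [->|f0]; first by left; rewrite eqxx.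
right; apply/eqP; apply: contrapT => g0.
have ex (h : coord_ring) : h <> 0 -> exists x, h x != 0.
  move=> h0; apply: contrapT => none; apply: h0; apply: coordP => x.
  by apply/eqP/negP => /negP hx; apply: none; exists x.
have [x fx] := ex f f0; have [y gy] := ex g g0.
have line (h : coord_ring) : exists p q : {poly C},
    forall t z, val z = val x + t *: (val y - val x) -> q.[t] != 0 /\ h z * q.[t] = p.[t].
  have [P [k [pP eP]]] := coord_regular h.
  have [d dP] := polyfun_polydeg pP.
  have [l dQ] := polyfun_polydeg (polyfun_exp k (polyfun_det C r)).
  have [P' [lP _]] := polydeg_line dP; have [Q' [lQ _]] := polydeg_line dQ.
  have [p [ep _]] := lP (val x) (val y - val x); have [q [eq _]] := lQ (val x) (val y - val x).
  exists p, q => t z tz; rewrite ep eq -tz eP.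
  by have n0 := expf_neq0 k (det_neq0 z); rewrite divfK.
have [p [q pq]] := line f; have [p' [q' pq']] := line g.
have : p * p' = 0.
  apply: (@poly_line_eq C r _ _ x (val y - val x)) => t z tz.
  have [_ e] := pq t z tz; have [_ e'] := pq' t z tz.
  rewrite hornerM -e -e' mulrACA -coordME fg [X in X * _]/(0 : C) mul0r horner0 //.
have ex0 : val x = val x + 0 *: (val y - val x) by rewrite scale0r addr0.
have ey1 : val y = val x + 1 *: (val y - val x) by rewrite scale1r addrC subrK.
move=> /eqP; rewrite mulf_eq0 => /orP[] /eqP p0.
  have [q0 e] := pq _ _ ex0; move: e; rewrite p0 horner0 => /eqP.
  by rewrite mulf_eq0 (negPf fx) (negPf q0).
have [q0 e] := pq' _ _ ey1; move: e; rewrite p0 horner0 => /eqP.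
by rewrite mulf_eq0 (negPf gy) (negPf q0).
Qed.

HB.instance Definition _ := GRing.ComUnitRing_isIntegral.Build coord_ring coord_integral.

Definition coord_const (c : C) : coord_ring := mk_coord (regular_const r c).

Lemma coord_const_zmod : zmod_morphism coord_const.
Proof. by move=> a b; apply: coordP. Qed.
Lemma coord_const_monoid : monoid_morphism coord_const.
Proof. by split; [|move=> a b]; apply: coordP. Qed.
HB.instance Definition _ :=
  GRing.isZmodMorphism.Build C coord_ring coord_const coord_const_zmod.
HB.instance Definition _ :=
  GRing.isMonoidMorphism.Build C coord_ring coord_const coord_const_monoid.

Definition coord_der (v : vfield C r) (dv : derivation v) (f : coord_ring) : coord_ring :=
  mk_coord (der_regular dv (coord_regular f)).

Lemma coord_der_derivation v (dv : derivation v) :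
  derivation_over coord_const (coord_der dv).
Proof.
split=> [f g|f g|c]; apply: coordP => x /=.
- exact: der_add (coord_regular f) (coord_regular g).
- exact: der_mul (coord_regular f) (coord_regular g).
exact: der_const.
Qed.

End CoordinateRing.

(** * Extension of a derivation to the fraction field *)

Section FractionDerivation.
Local Open Scope quotient_scope.
Variable A : idomainType.
Notation K := {fraction A}.
Notation "x %:F" := (@tofrac A x).

Lemma fracP (x : K) : exists a b : A, b != 0 /\ x * b%:F = a%:F.
Proof.
elim/quotW: x => x; exists (\n_x), (\d_x); split; first exact: denom_ratioP.
rewrite -[LHS]/(FracField.mul _ _) !piE; apply/eqmodP; rewrite /= FracField.equivfE.
rewrite /FracField.mulf !numden_Ratio ?(oner_eq0, mulf_neq0, denom_ratioP) //.
by rewrite !mulr1 mulrC.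
Qed.

Section Extension.
Variable D : A -> A.
Hypothesis DD : forall x y, D (x + y) = D x + D y.
Hypothesis DM : forall x y, D (x * y) = D x * y + x * D y.

(** The value is forced by differentiating x b = a. It uses a chosen representative; [frac_derE]
    shows that any other gives the same result. *)
Definition frac_der (x : K) : K :=
  let a := projT1 (cid (fracP x)) in let b := projT1 (cid (projT2 (cid (fracP x)))) in
  ((D a)%:F - x * (D b)%:F) / b%:F.

Lemma frac_derE x a b : b != 0 -> x * b%:F = a%:F ->
  frac_der x * b%:F = (D a)%:F - x * (D b)%:F.
Proof.
rewrite /frac_der; case: cid => a0 h /=; case: cid => b0 /= [b00 e0] bn0 e.
have b0F : b0%:F != 0 by rewrite tofrac_eq0.
have bF : b%:F != 0 by rewrite tofrac_eq0.
(* Two representatives satisfy a b0 = a0 b inside A, where D is already defined and can be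
   applied. *)
have : (a * b0)%:F == (a0 * b)%:F by rewrite !tofracM -e -e0 mulrAC.
rewrite tofrac_eq => /eqP /(congr1 (fun z => (D z)%:F)).
rewrite !DM !tofracD !tofracM -e -e0 => e2.
apply: (mulIf b0F); rewrite mulrAC divfK //.
move: (D a)%:F (D a0)%:F (D b)%:F (D b0)%:F b%:F b0%:F e2 => u u0 w w0 c c0 e2.
have -> : (u - x * w) * c0 = u * c0 + x * c * w0 - x * c * w0 - x * w * c0 by ring.
by rewrite e2; ring.
Qed.

Lemma frac_der_tofrac a : frac_der a%:F = (D a)%:F.
Proof.
have := @frac_derE a%:F a 1 (oner_neq0 _); rewrite tofrac1 !mulr1 Leibniz1 //.
by rewrite tofrac0 mulr0 subr0; apply.
Qed.

Lemma frac_derD x y : frac_der (x + y) = frac_der x + frac_der y.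
Proof.
have [a [b [b0 e]]] := fracP x; have [a' [b' [b0' e']]] := fracP y.
have bF : b%:F != 0 by rewrite tofrac_eq0.
have bF' : b'%:F != 0 by rewrite tofrac_eq0.
apply: (mulIf bF); apply: (mulIf bF'); rewrite -mulrA -tofracM.
rewrite (@frac_derE _ (a * b' + a' * b)); last 2 first.
- by rewrite mulf_neq0.
- by rewrite tofracD !tofracM -e -e'; ring.
rewrite ![in RHS]mulrDl [frac_der y * _ * _]mulrAC (frac_derE b0 e).
rewrite (frac_derE b0' e') DD !DM !tofracD !tofracM -e -e'; ring.
Qed.

Lemma frac_derM x y : frac_der (x * y) = frac_der x * y + x * frac_der y.
Proof.
have [a [b [b0 e]]] := fracP x; have [a' [b' [b0' e']]] := fracP y.
have bF : b%:F != 0 by rewrite tofrac_eq0.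
have bF' : b'%:F != 0 by rewrite tofrac_eq0.
apply: (mulIf bF); apply: (mulIf bF'); rewrite -mulrA -tofracM.
rewrite (@frac_derE _ (a * a')); last 2 first.
- by rewrite mulf_neq0.
- by rewrite !tofracM -e -e'; ring.
have -> : (frac_der x * y + x * frac_der y) * b%:F * b'%:F =
  (frac_der x * b%:F) * (y * b'%:F) + (x * b%:F) * (frac_der y * b'%:F) by ring.
rewrite (frac_derE b0 e) (frac_derE b0' e') !DM !tofracD !tofracM -e -e'; ring.
Qed.

End Extension.
End FractionDerivation.

(** * Flat invariant forms and representations of gl_r *)

Section InvariantForms.
Variables (C : numFieldType) (r n : nat).

Definition form_rep (b : invform C r n) (i j : 'I_r) : 'M[C]_n := \matrix_(k, l) b k l i j.

Lemma inv_pairingE (b : invform C r n) v x :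
  inv_pairing b v x = rep_ext idfun (form_rep b) (MaurerCartan v x).
Proof.
apply/matrixP => k l; rewrite mxE /rep_ext summxE; apply: eq_bigr => i _.
by rewrite summxE; apply: eq_bigr => j _; rewrite !mxE mulrC.
Qed.

Lemma regmx_MaurerCartan (v : vfield C r) : derivation v -> regmx (MaurerCartan v).
Proof.
by move=> dv; apply: regmx_mul; [exact: regmx_inv|exact: (regmx_Dmx dv (@regmx_val C r))].
Qed.

Lemma regmx_inv_pairing (b : invform C r n) v : derivation v -> regmx (inv_pairing b v).
Proof.
move=> dv k l; rewrite (_ : (fun _ => _) = fun x =>
    \sum_i \sum_j b k l i j * MaurerCartan v x i j); last first.
  by apply/funext => x; rewrite mxE.
apply: regular_sum => i; apply: regular_sum => j.
by apply: regular_mul; [exact: regular_const|exact: regmx_MaurerCartan].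
Qed.

(** Flatness is tested on the left-invariant fields x |-> x X, on which the
    Maurer--Cartan form is constant. *)
Lemma flat_gl_rep (b : invform C r n) : flat (inv_pairing b) -> gl_rep (form_rep b).
Proof.
move=> fb i j k l.
pose L (X : 'M[C]_r) := line_field (fun A : 'M[C]_r => A *m X).
have dL X : derivation (L X).
  apply: line_field_derivation => p q.
  rewrite (_ : (fun _ => _) = fun A : 'M[C]_r => \sum_s A p s * X s q); last first.
    by apply/funext => A; rewrite mxE.
  apply: fun_sum_closed => [|f g pf pg|s]; [exact: pf_const|exact: pf_add|].
  by apply: pf_mul; [exact: pf_coord|exact: (pf_const r)].
have DL X x : Dmx (L X) (fun y => val y) x = val x *m X.
  by apply/matrixP => p q; rewrite mxE /L line_field_coord.
have xu (x : GLpt C r) : val x \in unitmx by exact: valP.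
have mcL X : MaurerCartan (L X) = fun=> X.
  by apply/funext => x; rewrite /MaurerCartan DL mulKmx.
have alL X : inv_pairing b (L X) = fun=> rep_ext idfun (form_rep b) X.
  by apply/funext => x; rewrite inv_pairingE mcL.
(* The bracket of left-invariant fields is the left-invariant field of the commutator, checked on
   coordinate functions. *)
have mcB X Y x : MaurerCartan (vbracket (L X) (L Y)) x = X *m Y - Y *m X.
  have L2 U V p q : L U (L V (fun y => val y p q)) x = (val x *m U *m V) p q.
    have -> : L V (fun y => val y p q) = fun y => (val y *m V) p q.
      by apply/funext => y; rewrite /L line_field_coord.
    have := Dmx_mul (dL U) x (@regmx_val C r) (regmx_const r V).
    rewrite (Dmx_const (dL U)) mulmx0 addr0 DL => /matrixP/(_ p q) <-.
    by rewrite mxE.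
  have -> : MaurerCartan (vbracket (L X) (L Y)) x
      = invmx (val x) *m (val x *m (X *m Y - Y *m X)).
    rewrite /MaurerCartan; congr (_ *m _); apply/matrixP => p q.
    by rewrite mxE /vbracket !L2 mulmxBr !mulmxA !mxE.
  by rewrite mulKmx.
pose Ei : 'M[C]_r := delta_mx i j; pose Ek : 'M[C]_r := delta_mx k l.
(* The form takes constant values on these fields, so the derivative terms vanish and flatness
   reduces to [rho X, rho Y] = rho [X, Y]. *)
have := fb _ _ (dL Ei) (dL Ek) (GL1pt C r).
rewrite !alL !(Dmx_const (dL _)) inv_pairingE mcB subrr sub0r -addrA addrC.
move=> /eqP; rewrite subr_eq0 => /eqP; rewrite !rep_ext_delta !map_mx_id // => ->.
rewrite !mul_delta_mx_cond linearB -!scaler_nat !linearZ /= !rep_ext_delta.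
by rewrite !map_mx_id // scalerN.
Qed.

End InvariantForms.

(** * Matrices of functions, over the coordinate ring and over its fraction field *)

Section Evaluation.
Variables (C : numFieldType) (r : nat).
Notation A := (coord_ring C r).
Notation "x %:F" := (@tofrac A x).

Definition coord_eval (x : GLpt C r) (f : A) : C := f x.
Lemma coord_eval_zmod x : zmod_morphism (coord_eval x). Proof. by []. Qed.
Lemma coord_eval_monoid x : monoid_morphism (coord_eval x). Proof. by []. Qed.
HB.instance Definition _ x :=
  GRing.isZmodMorphism.Build A C (coord_eval x) (coord_eval_zmod x).
HB.instance Definition _ x :=
  GRing.isMonoidMorphism.Build A C (coord_eval x) (coord_eval_monoid x).

Definition coord_mx p q (F : GLpt C r -> 'M[C]_(p, q)) (rF : regmx F) : 'M[A]_(p, q) :=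
  \matrix_(i, j) mk_coord (rF i j).

Lemma eval_coord_mx p q (F : GLpt C r -> 'M[C]_(p, q)) (rF : regmx F) x :
  map_mx (coord_eval x) (coord_mx rF) = F x.
Proof. by apply/matrixP => i j; rewrite !mxE. Qed.

Lemma coord_mxP p q (M N : 'M[A]_(p, q)) :
  (forall x, map_mx (coord_eval x) M = map_mx (coord_eval x) N) -> M = N.
Proof.
move=> h; apply/matrixP => i j; apply: coordP => x.
by have /matrixP/(_ i j) := h x; rewrite !mxE.
Qed.

Lemma regmx_eval p q (M : 'M[A]_(p, q)) : regmx (fun x => map_mx (coord_eval x) M).
Proof.
move=> i j; rewrite (_ : (fun _ => _) = M i j); first exact: coord_regular.
by apply/funext => x; rewrite mxE.
Qed.

Lemma Dmx_eval p q v (dv : derivation v) (M : 'M[A]_(p, q)) x :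
  Dmx v (fun y => map_mx (coord_eval y) M) x
  = map_mx (coord_eval x) (map_mx (coord_der dv) M).
Proof.
apply/matrixP => i j; rewrite !mxE /coord_eval /=.
by congr (v _ _); apply/funext => y; rewrite mxE.
Qed.

Lemma map_tofrac_inj p q (M N : 'M[A]_(p, q)) :
  map_mx (@tofrac A) M = map_mx (@tofrac A) N -> M = N.
Proof.
move=> /matrixP h; apply/matrixP => i j; apply/eqP; rewrite -tofrac_eq.
by have := h i j; rewrite !mxE => ->.
Qed.

Definition vder v (dv : derivation v) : {fraction A} -> {fraction A} := frac_der (coord_der dv).

Lemma vder_tofrac v (dv : derivation v) (a : A) : vder dv a%:F = (coord_der dv a)%:F.
Proof. by have [DD DM _] := coord_der_derivation dv; exact: frac_der_tofrac. Qed.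

Lemma vder_derivation v (dv : derivation v) :
  derivation_over (@tofrac A \o @coord_const C r) (vder dv).
Proof.
have [DD DM Dc] := coord_der_derivation dv; split.
- exact: frac_derD.
- exact: frac_derM.
by move=> c /=; rewrite vder_tofrac Dc tofrac0.
Qed.

Lemma map_vder_tofrac v (dv : derivation v) p q (M : 'M[A]_(p, q)) :
  map_mx (vder dv) (map_mx (@tofrac A) M) = map_mx (@tofrac A) (map_mx (coord_der dv) M).
Proof. by apply/matrixP => i j; rewrite !mxE vder_tofrac. Qed.

Lemma common_denominator p q (M : 'M[{fraction A}]_(p, q)) :
  exists2 a : A, a != 0 & exists N, a%:F *: M = map_mx (@tofrac A) N.
Proof.
suff [a a0 h] : exists2 a : A, a != 0 &
    forall ij, ij \in enum [set: 'I_p * 'I_q] -> exists c, a%:F * M ij.1 ij.2 = c%:F.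
  exists a => //.
  have h' i j : exists c, a%:F * M i j = c%:F by apply: (h (i, j)); rewrite mem_enum inE.
  exists (\matrix_(i, j) projT1 (cid (h' i j))); apply/matrixP => i j.
  by rewrite !mxE; case: cid.
elim: (enum _) => [|[i j] s [a a0 h]]; first by exists 1 => //; exact: oner_neq0.
have [c [b [b0 e]]] := fracP (M i j).
exists (a * b); first by rewrite mulf_neq0.
move=> ij; rewrite inE => /orP[/eqP->|/h [d ed]] /=.
  by exists (a * c); rewrite !tofracM -e; ring.
by exists (b * d); rewrite !tofracM -ed; ring.
Qed.

(** Coefficients are allowed on both sides of M so that the equations of G and of its inverse both
    have this shape. *)
Lemma regular_of_ode n (M : 'M[{fraction A}]_n) :
  (forall v (dv : derivation v), exists P Q : 'M[A]_n,
     map_mx (vder dv) M = M *m map_mx (@tofrac A) P + map_mx (@tofrac A) Q *m M) ->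
  exists N, M = map_mx (@tofrac A) N.
Proof.
move=> ode.
pose I (h : GLpt C r -> C) := exists a : A, h = a /\ exists N, a%:F *: M = map_mx (@tofrac A) N.
suff [a [a1 [N eN]]] : I (fun=> 1).
  exists N; rewrite -eN (_ : a = 1) ?tofrac1 ?scale1r //.
  by apply: coordP => x; rewrite -a1.
have [a a0 eN] := common_denominator M.
have [x ax] : exists x, a x != 0.
  apply: contrapT => none; move/eqP: a0; apply; apply: coordP => x.
  by apply/eqP/negP => /negP hx; apply: none; exists x.
apply: (@differential_ideal_1 C r I _ _ a x) => //;
  [| |exact: coord_regular|by exists a].
- move=> f h rf [c [-> [N hN]]]; exists (mk_coord rf * c); split=> //.
  exists (mk_coord rf *: N); rewrite tofracM -scalerA hN.
  by apply/matrixP => i j; rewrite !mxE tofracM.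
move=> i j h _ [c [-> [N hN]]].
have dv : derivation (@line_field C r (fun=> delta_mx i j)).
  by apply: line_field_derivation => k l; exact: pf_const.
have [P [Q e]] := ode _ dv; have [DD DM _] := vder_derivation dv.
exists (coord_der dv c); split=> //.
(* With cM = N regular, (Dc) M = D(cM) - c DM, and c DM = N P + Q N is regular as well. *)
exists (map_mx (coord_der dv) N - (N *m P + Q *m N)).
rewrite -vder_tofrac map_mxB -map_vder_tofrac -hN map_LeibnizZ // e map_mxD !map_mxM -hN.
by rewrite -scalemxAl -scalemxAr -scalerDr addrK.
Qed.

End Evaluation.

(** * Every flat invariant form is gauge equivalent to a pullback along det *)

Section Surjectivity.
Variables (C : numFieldType) (r n : nat).
Notation A := (coord_ring C r.+1).
Notation K := {fraction A}.

Lemma inv_pairing_gauge (b : invform C r.+1 n) : flat (inv_pairing b) ->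
  exists F F', gauge_equiv (inv_pairing b)
    (det_pullback r.+1 (fun k l => const_mx (b k l ord_max ord_max))) F F'.
Proof.
move=> /flat_gl_rep rep.
pose iota : {rmorphism C -> K} := @tofrac A \o @coord_const C r.+1.
pose X : 'M[A]_r.+1 := coord_mx (@regmx_val C r.+1).
pose g := map_mx (@tofrac A) X.
have eX x : map_mx (coord_eval x) X = val x by exact: eval_coord_mx.
have edet x : (\det X) x = \det (val x).
  by rewrite -eX det_map_mx.
pose dV : A := mk_coord (@regular_detV C r.+1).
have detV : \det X * dV = 1.
  by apply: coordP => x; rewrite coordME edet mulfV // det_neq0.
have detg : \det g = @tofrac A (\det X) by rewrite det_map_mx.
have dVF : @tofrac A dV = (\det g)^-1.
  have h : \det g * @tofrac A dV = 1 by rewrite detg -tofracM detV tofrac1.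
  have d0 : \det g != 0.
    by apply/eqP => d0; move: h; rewrite d0 mul0r => /eqP; rewrite eq_sym oner_eq0.
  by apply: (mulfI d0); rewrite h mulfV.
have gu : g \in unitmx.
  rewrite unitmxE unitfE detg tofrac_eq0; apply/eqP => d0.
  by move: detV; rewrite d0 mul0r => /eqP; rewrite eq_sym oner_eq0.
have [G Gu eG] := gl_gauge iota rep ord_max gu.
pose B := map_mx (@coord_const C r.+1) (form_rep b ord_max ord_max).
have eB : map_mx iota (form_rep b ord_max ord_max) = map_mx (@tofrac A) B.
  by rewrite -map_mx_comp.
pose W v (dv : derivation v) : 'M[A]_n := coord_mx (@regmx_inv_pairing C r.+1 n b v dv).
have eW v (dv : derivation v) :
    rep_ext iota (form_rep b) (invmx g *m map_mx (vder dv) g) = map_mx (@tofrac A) (W v dv).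
  (* The Maurer--Cartan matrix of a field has regular entries, so the logarithmic derivative of the
     generic matrix descends from K to A. *)
  pose Y : 'M[A]_r.+1 := coord_mx (regmx_MaurerCartan dv).
  have -> : invmx g *m map_mx (vder dv) g = map_mx (@tofrac A) Y.
    apply: (can_inj (mulKmx gu)); rewrite (mulKVmx gu) map_vder_tofrac -map_mxM.
    congr map_mx; apply: coord_mxP => x; rewrite map_mxM eX eval_coord_mx -Dmx_eval.
    rewrite /MaurerCartan mulKVmx; last exact: valP.
    by congr Dmx; apply/funext => y; rewrite eX.
  rewrite /rep_ext; apply/matrixP => k l; rewrite summxE !mxE.
  have -> : mk_coord (regmx_inv_pairing b dv k l) =
      \sum_i \sum_j Y i j * coord_const r.+1 (b k l i j).
    apply: coordP => x; rewrite -[RHS]/(coord_eval x _) rmorph_sum /= mxE.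
    apply: eq_bigr => i _; rewrite rmorph_sum; apply: eq_bigr => j _.
    by rewrite rmorphM [RHS]mulrC; congr (_ * _); rewrite /Y [in RHS]mxE.
  rewrite rmorph_sum; apply: eq_bigr => i _; rewrite summxE rmorph_sum.
  by apply: eq_bigr => j _; rewrite rmorphM !mxE.
pose l v (dv : derivation v) : A := coord_der dv (\det X) * dV.
have el v (dv : derivation v) : vder dv (\det g) / \det g = @tofrac A (l v dv).
  by rewrite detg vder_tofrac -detg -dVF -tofracM.
have odeG v (dv : derivation v) : map_mx (vder dv) G
    = G *m map_mx (@tofrac A) (W v dv) - map_mx (@tofrac A) (l v dv *: B) *m G.
  rewrite eG; last exact: vder_derivation.
  by rewrite eW el eB map_mxZ -scalemxAl.
have [N eN] : exists N, G = map_mx (@tofrac A) N.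
  apply: regular_of_ode => v dv; exists (W v dv), (- (l v dv *: B)).
  by rewrite odeG map_mxN mulNmx.
(* Invertibility over K does not give a regular inverse. Differentiating G G^-1 = 1 yields the dual
   equation, and the same denominator argument applies to it. *)
have [N' eN'] : exists N', invmx G = map_mx (@tofrac A) N'.
  apply: regular_of_ode => v dv; exists (l v dv *: B), (- W v dv).
  have [DD DM _] := vder_derivation dv.
  have := map_LeibnizM DD DM G (invmx G); rewrite (mulmxV Gu) (map_Leibniz1 DD DM).
  move=> /esym/eqP; rewrite addrC addr_eq0 => /eqP h.
  apply: (can_inj (mulKmx Gu)); rewrite h odeG mulmxBl -[_ *m G *m _]mulmxA (mulmxV Gu).
  rewrite mulmx1 opprB mulmxDr !mulmxA (mulmxV Gu) mul1mx.
  by rewrite (map_mxN (@tofrac A) (W v dv)) mulmxN mulNmx addrC.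
have NN' : N *m N' = 1%:M.
  by apply: map_tofrac_inj; rewrite map_mxM -eN -eN' (mulmxV Gu) map_mx1.
exists (fun x => map_mx (coord_eval x) N), (fun x => map_mx (coord_eval x) N').
split; [exact: regmx_eval|exact: regmx_eval| |].
  by move=> x; rewrite -map_mxM NN' map_mx1.
move=> v dv x; rewrite Dmx_eval.
have -> : map_mx (coord_der dv) N = N *m W v dv - (l v dv *: B) *m N.
  by apply: map_tofrac_inj; rewrite -map_vder_tofrac -eN odeG map_mxB !map_mxM -eN.
rewrite map_mxB !map_mxM map_mxZ eval_coord_mx.
have -> : det_pullback r.+1 (fun k l => const_mx (b k l ord_max ord_max)) v x
    = coord_eval x (l v dv) *: map_mx (coord_eval x) B.
  apply/matrixP => k m; rewrite !mxE mulrC; congr (_ * _).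
  rewrite /coord_eval coordME /=; congr (v _ _ * _).
  by apply/funext => y; rewrite edet.
by rewrite subrK.
Qed.

End Surjectivity.

(** * Jacobi's formula and the form dlog det *)

Section Jacobi.
Variables (B : comNzRingType) (D : B -> B).
Hypothesis DD : forall x y, D (x + y) = D x + D y.
Hypothesis DM : forall x y, D (x * y) = D x * y + x * D y.

Lemma Leibniz_prod (I : eqType) (s : seq I) (F : I -> B) : uniq s ->
  D (\prod_(i <- s) F i) = \sum_(i <- s) D (F i) * \prod_(j <- s | j != i) F j.
Proof.
elim: s => [|i s IH] /=; first by rewrite !big_nil Leibniz1.
move=> /andP[is_ us]; rewrite !big_cons DM IH // eqxx /=; congr (_ + _).
  congr (_ * _); rewrite [RHS]big_seq_cond [LHS]big_seq; apply: eq_bigl => j.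
  by case js: (j \in s) => //=; apply/esym/eqP => e; rewrite -e js in is_.
rewrite mulr_sumr [LHS]big_seq [RHS]big_seq; apply: eq_bigr => j js.
rewrite big_cons (_ : i != j); first by rewrite mulrCA.
by apply: contraNneq is_ => ->.
Qed.

(** D acts on one row at a time; expanding each resulting determinant along its differentiated row
    produces the cofactors. *)
Lemma Leibniz_det r (M : 'M[B]_r) : D (\det M) = \tr (\adj M *m map_mx D M).
Proof.
pose Mi i : 'M[B]_r := \matrix_(k, l) if k == i then D (M k l) else M k l.
have -> : D (\det M) = \sum_i \det (Mi i).
  rewrite /determinant (Leibniz_sum DD) exchange_big; apply: eq_bigr => s _ /=.
  rewrite DM.
  have -> : D ((-1) ^+ s) = 0.
    by case: (odd_perm s); rewrite ?expr0 ?expr1 ?(LeibnizN DD) Leibniz1 // oppr0.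
  rewrite mul0r add0r (Leibniz_prod _ (index_enum_uniq _)) mulr_sumr.
  apply: eq_bigr => i _; congr (_ * _); rewrite [RHS](bigD1 i) //= mxE eqxx.
  by congr (_ * _); apply: eq_bigr => j ji; rewrite mxE (negPf ji).
rewrite mxtrace_mulC /mxtrace; apply: eq_bigr => i _.
rewrite (expand_det_row _ i) mxE; apply: eq_bigr => j _.
rewrite !mxE eqxx; congr (_ * _); congr (_ * \det _).
by apply/matrixP => k l; rewrite !mxE eq_sym (negPf (neq_lift _ _)).
Qed.

End Jacobi.

Section LogarithmicForms.
Variables (C : numFieldType) (r n : nat).

Definition dlogdet (v : vfield C r) (x : GLpt C r) : C :=
  v (fun y => \det (val y)) x / \det (val x).

(** This identifies dlog det with tr(g^-1 dg), and so exhibits it as a left-invariant form. *)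
Lemma mxtrace_MaurerCartan v x : derivation v -> \tr (MaurerCartan v x) = dlogdet v x.
Proof.
move=> dv; have [DD DM _] := coord_der_derivation dv.
pose X := coord_mx (@regmx_val C r).
have eX y : map_mx (coord_eval y) X = val y by exact: eval_coord_mx.
have := congr1 (coord_eval x) (Leibniz_det DD DM X).
rewrite -[RHS]trace_map_mx map_mxM map_mx_adj eX -Dmx_eval.
rewrite (_ : (fun y => _) = (fun y => val y)); last by apply/funext.
rewrite /dlogdet /coord_eval /=.
rewrite (_ : coord_fun (\det X) = fun y => \det (val y)); last first.
  by apply/funext => y; rewrite -eX det_map_mx.
move=> ->; rewrite /MaurerCartan /invmx (valP x) -scalemxAl linearZ /= mulrC.
by [].
Qed.

Lemma det_pullbackE (a : invform C 1 n) v x :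
  det_pullback r a v x = dlogdet v x *: \matrix_(k, l) a k l 0 0.
Proof. by apply/matrixP => k l; rewrite !mxE mulrC. Qed.

Definition scalar_form (a : invform C 1 n) : invform C r n := fun k l => (a k l 0 0)%:M.

Lemma inv_pairing_scalar (a : invform C 1 n) v x : derivation v ->
  inv_pairing (scalar_form a) v x = det_pullback r a v x.
Proof.
move=> dv; apply/matrixP => k l; rewrite !mxE -/(dlogdet v x).
rewrite -mxtrace_MaurerCartan // /mxtrace mulr_sumr; apply: eq_bigr => i _.
rewrite (bigD1 i) //= big1 ?addr0 => [|j ji]; first by rewrite mxE eqxx.
by rewrite mxE eq_sym (negPf ji) mul0r.
Qed.

Lemma regular_dlogdet v : derivation v -> regular (dlogdet v).
Proof.
move=> dv; apply: regular_mul; last exact: regular_detV.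
exact: der_regular (regular_det C r).
Qed.

Lemma dlogdet_closed u v x : derivation u -> derivation v ->
  u (dlogdet v) x - v (dlogdet u) x = dlogdet (vbracket u v) x.
Proof.
move=> du dv; have d0 := det_neq0 x.
(* The product rule for w'(det) = dlogdet(w') det avoids differentiating 1/det. On antisymmetrizing,
   the first-order products cancel. *)
have h w w' : derivation w -> derivation w' -> w (dlogdet w') x * \det (val x)
    = w (w' (fun y => \det (val y))) x - dlogdet w' x * w (fun y => \det (val y)) x.
  move=> dw dw'.
  have := der_mul dw x (regular_dlogdet dw') (@regular_det C r).
  rewrite (_ : (fun y => _) = w' (fun y => \det (val y))); last first.
    by apply/funext => y; rewrite /dlogdet divfK // det_neq0.
  by move=> ->; rewrite addrK.
apply: (mulIf d0); rewrite mulrBl !h // /dlogdet divfK // /vbracket.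
by field.
Qed.

(** The form is dlog det times one constant matrix B: dlog det is closed, and the wedge square
    vanishes because B commutes with itself. *)
Lemma flat_scalar_form (a : invform C 1 n) : flat (inv_pairing (scalar_form a)).
Proof.
move=> u v du dv x; set B : 'M[C]_n := \matrix_(k, l) a k l 0 0.
have E w : derivation w -> inv_pairing (scalar_form a) w = fun y => dlogdet w y *: B.
  by move=> dw; apply/funext => y; rewrite inv_pairing_scalar // det_pullbackE.
rewrite !E //; last exact: derivation_bracket.
rewrite (Dmx_scale du) ?(Dmx_scale dv) ?(Dmx_const du) ?(Dmx_const dv);
  try exact: regular_dlogdet; try exact: regmx_const.
rewrite !scaler0 !addr0 -!scalerBl dlogdet_closed // subrr scale0r add0r.
by rewrite -!scalemxAl -!scalemxAr !scalerA mulrC subrr.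
Qed.

End LogarithmicForms.

(** * Transport of gauge equivalences along maps that preserve the determinant *)

Section Pullback.
Variables (C : numFieldType) (n : nat).

Lemma gauge_equiv_eq r (al be al' be' : pairing C r n) F F' :
  (forall v x, derivation v -> al v x = al' v x) ->
  (forall v x, derivation v -> be v x = be' v x) ->
  gauge_equiv al be F F' -> gauge_equiv al' be' F F'.
Proof.
by move=> ea eb [rF rF' FF' e]; split=> // v dv x; rewrite -ea // -eb // e.
Qed.

Lemma regmx_det_pullback r (a : invform C 1 n) v :
  derivation v -> regmx (det_pullback r a v).
Proof.
move=> dv; rewrite (_ : det_pullback r a v =
    fun x => dlogdet v x *: \matrix_(k, l) a k l 0 0); last first.
  by apply/funext => x; rewrite det_pullbackE.
by apply: regmx_scale; [exact: regular_dlogdet|exact: regmx_const].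
Qed.

(** By the chain rule, a field v at x acts on functions composed with phi as
    the constant field d phi_x(v) acts at phi(x). *)
Lemma gauge_equiv_comp p q (phi : GLpt C p -> GLpt C q) (a a' : invform C 1 n) F F' :
  regmx (fun x => val (phi x)) -> (forall x, \det (val (phi x)) = \det (val x)) ->
  gauge_equiv (det_pullback q a) (det_pullback q a') F F' ->
  gauge_equiv (det_pullback p a) (det_pullback p a')
    (fun x => F (phi x)) (fun x => F' (phi x)).
Proof.
move=> rphi dphi [rF rF' FF' e].
have rdV : regular (fun x => (\det (val (phi x)))^-1).
  rewrite (_ : (fun _ => _) = fun x : GLpt C p => (\det (val x))^-1).
    exact: regular_detV.
  by apply/funext => x; rewrite dphi.
split=> //.
- by move=> i j; apply: (regular_comp rphi rdV (f := fun y => F y i j)).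
- by move=> i j; apply: (regular_comp rphi rdV (f := fun y => F' y i j)).
move=> v dv x.
pose w := @line_field C q (fun=> Dmx v (fun y => val (phi y)) x).
have dw : derivation w by apply: line_field_derivation => i j; exact: pf_const.
have wE f : regular f -> w f (phi x) = v (fun y => f (phi y)) x.
  by move=> rf; apply: line_fieldE; exact: chain_rule.
have -> : Dmx v (fun y => F (phi y)) x = Dmx w F (phi x).
  by apply/matrixP => i j; rewrite !mxE wE.
have lE : dlogdet v x = dlogdet w (phi x).
  rewrite /dlogdet wE; last exact: regular_det.
  by rewrite dphi; congr (v _ _ / _); apply/funext => y; rewrite dphi.
by have := e w dw (phi x); rewrite !det_pullbackE lE.
Qed.

Definition det_hom r (x : GLpt C r) : GLpt C 1.
Proof.
exists (\det (val x))%:M; abstract by rewrite unitmxE det_scalar1 unitfE det_neq0.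
Defined.

Definition det_section r (t : GLpt C 1) : GLpt C r.+1.
Proof.
exists (1%:M + (\det (val t) - 1) *: delta_mx 0 0).
abstract by rewrite unitmxE det_one_plus_delta addrC subrK unitfE det_neq0.
Defined.

(** On GL_1 the matrix is its own determinant, so det and its section both preserve determinants and
    one composition lemma serves both directions. *)
Lemma gauge_equiv_det r (a a' : invform C 1 n) :
  (exists F F', gauge_equiv (det_pullback 1 a) (det_pullback 1 a') F F') <->
  (exists F F', gauge_equiv (det_pullback r.+1 a) (det_pullback r.+1 a') F F').
Proof.
split=> -[F [F' h]]; do 2 eexists.
  apply: (gauge_equiv_comp (phi := @det_hom r.+1)) h => [i j|x]; last exact: det_scalar1.
  rewrite (_ : (fun _ => _) = fun x : GLpt C r.+1 => \det (val x)); first exact: regular_det.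
  by apply/funext => x; rewrite !ord1 mxE eqxx.
apply: (gauge_equiv_comp (phi := @det_section r)) h => [|x]; last first.
  by rewrite /= det_one_plus_delta addrC subrK.
apply: regmx_add; first exact: regmx_const.
apply: regmx_scale; last exact: regmx_const.
by apply: regular_add; [exact: regular_det|exact: regular_const].
Qed.

End Pullback.

Theorem theorem4p1 (R : realType) (r n : nat) (hr : (0 < r)%N) (hn : (0 < n)%N) :
  (* det^* lands in invariant D-modules (up to isomorphism) *)
  [/\ (forall a : invform R[i] 1 n, flat (inv_pairing a) ->
         exists b : invform R[i] r n,
           flat (inv_pairing b) /\ Dmod_iso (inv_pairing b) (det_pullback r a)),
  (* well defined and injective on isomorphism classes *)
      (forall a a' : invform R[i] 1 n, flat (inv_pairing a) -> flat (inv_pairing a') ->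
         Dmod_iso (inv_pairing a) (inv_pairing a') <->
         Dmod_iso (det_pullback r a) (det_pullback r a'))
  (* surjective on isomorphism classes *)
    & (forall b : invform R[i] r n, flat (inv_pairing b) ->
         exists a : invform R[i] 1 n,
           flat (inv_pairing a) /\ Dmod_iso (inv_pairing b) (det_pullback r a))].
Proof.
case: r hr => // r _.
(* On GL_1 every coefficient is a 1 by 1 matrix, hence scalar; each invariant form on G_m is thus
   its own pullback along the determinant of GL_1. *)
have one (a : invform R[i] 1 n) : a = scalar_form 1 a.
  apply/funext => k; apply/funext => l; apply/matrixP => i j.
  by rewrite !ord1 mxE eqxx.
have oneE (a : invform R[i] 1 n) v x :
    derivation v -> inv_pairing a v x = det_pullback 1 a v x.
  by move=> dv; rewrite {1}(one a) inv_pairing_scalar.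
split=> [a _|a a' _ _|b fb].
(* The two forms agree on all derivations, so the identity matrix is the gauge transformation. *)
- exists (scalar_form r.+1 a); split; first exact: flat_scalar_form.
  apply/(Dmod_isoP _ (@regmx_inv_pairing _ _ _ _)).
  exists (fun=> 1%:M), (fun=> 1%:M); split.
  + exact: regmx_const.
  + exact: regmx_const.
  + by move=> x; rewrite mulmx1.
  by move=> v dv x; rewrite (Dmx_const dv) add0r mulmx1 mul1mx inv_pairing_scalar.
- rewrite (Dmod_isoP _ (@regmx_inv_pairing _ _ _ _)) (Dmod_isoP _ (@regmx_det_pullback _ _ _ _)).
  rewrite -gauge_equiv_det; split=> -[F [F' h]]; exists F, F'.
    by apply: gauge_equiv_eq h => v x dv; exact: oneE.
  by apply: gauge_equiv_eq h => v x dv; rewrite oneE.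
(* The form rho(E_rr) dt/t; its flatness holds because forms on G_m are scalar forms. *)
exists (fun k l => const_mx (b k l ord_max ord_max)); split.
  rewrite [X in inv_pairing X]one; exact: flat_scalar_form.
apply/(Dmod_isoP _ (@regmx_inv_pairing _ _ _ _)); exact: inv_pairing_gauge.
Qed.
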